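(* Let $X$ be a symmetric space on $[0,1]$, $X\ne L_\infty[0,1]$, and let the fundamental function $\phi_X$ of $X$ satisfy $$\limsup_{t\to0+}\phi_X(t)\,t^{-1/2}=\infty .$$ Then $X$ does not have the property (IR).
   Context: All functions are real-valued Lebesgue measurable functions on $[0,1]$ with Lebesgue measure $m$ (modulo a.e. equality); independence is with respect to $m$. Symmetric space (s.s.) on $[0,1]$: a Banach space $X$ of measurable functions on $[0,1]$ such that (1) if $x\in X$ and $y$ is measurable with $|y|\le|x|$ a.e., then $y\in X$ and $\|y\|_X\le\|x\|_X$; (2) if $x\in X$ and $|x|,|y|$ are identically distributed, then $y\in X$ and $\|y\|_X=\|x\|_X$. It is assumed throughout that $\|\chi_{[0,1]}\|_X=1$. Fundamental function: $\phi_X(t):=\|\chi_{(0,t]}\|_X$. Kolmogorov width: for $K\subset X$, $d_n(K,X):=\inf_{\dim V\le n}\sup_{x\in K}\inf_{v\in V}\|x-v\|_X$, the infimum over linear subspaces $V\subset X$ of dimension at most $n$; for non-integer $r$, $d_r:=d_{\lfloor r\rfloor}$. Property (IR): $X$ has the property (IR) if there exists $\gamma>0$ such that for any $N\in\mathbb N$ and arbitrary independent functions $f_1,\ldots,f_N\in X$ with $\int_0^1f_k(x)\,dx=0$ and $\|f_k\|_X\ge1$, $k=1,\ldots,N$, we have $d_{\gamma N}(\{f_1,\ldots,f_N\},X)\ge\gamma$. *)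

(* Defs.v *)
From HB Require Import structures.
From mathcomp Require Import all_boot all_order all_algebra.
From mathcomp Require Import all_classical all_reals all_analysis.

Set Implicit Arguments.
Unset Strict Implicit.
Unset Printing Implicit Defensive.

Import Order.TTheory GRing.Theory Num.Theory.
Import numFieldNormedType.Exports.

Local Open Scope classical_set_scope.
Local Open Scope ring_scope.

(* The carrier R with the sigma-algebra of Lebesgue measurable sets, i.e. the
   domain of completed_lebesgue_measure (plain R carries the Borel sets). *)
Notation lebT R := (caratheodory_type (wlength (@idfun R))^*%mu).

Notation leb := completed_lebesgue_measure.

(* A function on [0, 1] is a total function x : lebT R -> R of which only the
   values on unitI matter; functions equal a.e. on unitI are identified by
   ss_norm_eq0 below. *)
Definition unitI {R : realType} : set (lebT R) := `[0%R, 1%R]%classic.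

Definition equidistributed (R : realType) (x y : lebT R -> R) : Prop :=
  forall B : set R, measurable B ->
    leb (unitI `&` x @^-1` B) = leb (unitI `&` y @^-1` B).

(* Proper subfamilies are covered by taking B k = setT. *)
Definition independent (R : realType) (N : nat) (f : 'I_N -> lebT R -> R)
    : Prop :=
  forall B : 'I_N -> set R, (forall k, measurable (B k)) ->
    leb (unitI `&` [set t | forall k, B k (f k t)]) =
    (\prod_(k < N) leb (unitI `&` f k @^-1` B k))%E.

Definition Linfty (R : realType) : set (lebT R -> R) :=
  [set x | x \_ unitI \in Lfun leb +oo%E].

(* ss_norm is a total function, meaningful on ss_mem only. *)
Record symmetric_space (R : realType) := SymmetricSpace {
  ss_mem : set (lebT R -> R) ;
  ss_norm : (lebT R -> R) -> R ;
  ss_measurable : forall x, ss_mem x -> measurable_fun unitI x ;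
  ss_mem0 : ss_mem (fun=> 0) ;
  ss_memD : forall x y, ss_mem x -> ss_mem y -> ss_mem (fun t => x t + y t) ;
  ss_memZ : forall (a : R) x, ss_mem x -> ss_mem (fun t => a * x t) ;
  ss_norm_ge0 : forall x, ss_mem x -> 0 <= ss_norm x ;
  ss_norm_eq0 : forall x, ss_mem x ->
    (ss_norm x = 0 <-> {ae leb, forall t, unitI t -> x t = 0}) ;
  ss_normD : forall x y, ss_mem x -> ss_mem y ->
    ss_norm (fun t => x t + y t) <= ss_norm x + ss_norm y ;
  ss_normZ : forall (a : R) x, ss_mem x ->
    ss_norm (fun t => a * x t) = `|a| * ss_norm x ;
  ss_complete : forall u : nat -> lebT R -> R, (forall n, ss_mem (u n)) ->
    (forall e : R, 0 < e -> exists n0 : nat, forall p q : nat,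
      (n0 <= p)%N -> (n0 <= q)%N -> ss_norm (fun t => u p t - u q t) < e) ->
    exists2 x, ss_mem x &
      (fun n => ss_norm (fun t => u n t - x t)) @ \oo --> (0 : R) ;
  ss_ideal : forall x (y : lebT R -> R), ss_mem x -> measurable_fun unitI y ->
    {ae leb, forall t, unitI t -> `|y t| <= `|x t|} ->
    ss_mem y /\ ss_norm y <= ss_norm x ;
  ss_symmetric : forall x (y : lebT R -> R), ss_mem x -> measurable_fun unitI y ->
    equidistributed (fun t => `|x t|) (fun t => `|y t|) ->
    ss_mem y /\ ss_norm y = ss_norm x ;
  ss_mem1 : ss_mem \1_unitI ;
  ss_norm1 : ss_norm \1_unitI = 1
}.

Definition fundamental_function (R : realType) (X : symmetric_space R) (t : R) : R :=
  ss_norm X \1_(`]0%R, t]%classic : set (lebT R)).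

Definition linear_subspace (R : realType) (X : symmetric_space R)
    (V : set (lebT R -> R)) : Prop :=
  [/\ V `<=` ss_mem X, V (fun=> 0),
      (forall u v, V u -> V v -> V (fun t => u t + v t)) &
      (forall (a : R) u, V u -> V (fun t => a * u t))].

(* Dimension of V modulo a.e. equality on [0, 1]: n elements of V span it. *)
Definition dim_le (R : realType) (V : set (lebT R -> R)) (n : nat) : Prop :=
  exists2 b : 'I_n -> lebT R -> R, (forall i, V (b i)) &
    forall v, V v -> exists c : 'I_n -> R,
      {ae leb, forall t, unitI t -> v t = \sum_(i < n) c i * b i t}.

Definition kolmogorov_width (R : realType) (X : symmetric_space R)
    (K : set (lebT R -> R)) (n : nat) : \bar R :=
  ereal_inf
    [set ereal_sup
       [set ereal_inf [set (ss_norm X (fun t => x t - v t))%:E | v in V]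
       | x in K]
    | V in [set V | linear_subspace X V /\ dim_le V n]].

(* N > 0 is needed: the supremum over an empty K is -oo in \bar R. *)
Definition property_IR (R : realType) (X : symmetric_space R) : Prop :=
  exists2 gamma : R, 0 < gamma &
    forall (N : nat) (f : 'I_N -> lebT R -> R), (0 < N)%N ->
      (forall k, ss_mem X (f k)) -> independent f ->
      (forall k, (\int[leb]_(t in unitI) (f k t)%:E)%E = 0%E) ->
      (forall k, 1 <= ss_norm X (f k)) ->
      (gamma%:E <= kolmogorov_width X (range f) (Num.truncn (gamma * N%:R)))%E.

(* Main.v *)
(** Let [f_1, ..., f_N] be independent copies of the function taking the values
    [c, -c] with probability [1 / (2 q)] each and [0] otherwise, normalized by
    [c = 1 / phi_X (1 / q)]. Up to the factor [c], the values of [(f_1, ..., f_N)]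
    form a vector with entries in [{-1, 0, 1}] which, outside a set of
    exponentially small measure, has at most a multiple of [N / q] nonzero
    entries. Take [n = floor (gamma N)] random sign vectors; [G], the matrix with
    these rows, satisfies [||G z||^2 ~ n ||z||^2] for all integer vectors [z] with
    [||z||^2 <= 4 B], where [B = N / p] and [p] depends on [gamma] only. Hence every
    integer vector with [||z||^2 <= B] is within distance 2 of the row space of
    [G] in the sup norm: the residual [r = z - G^T G z / n] truncates to an integer
    vector [w ~ 2 r] with again [||w||^2 <= B], since otherwise a vector
    between 0 and [w] would correlate too much with [r], and one iterates.
    Applying this to [m z] with [m ~ sqrt (q / (4 p))] shows that the [f_k] are
    approximated by an [n]-dimensional space up to [2 c / m], plus [c] on the
    exceptional set. The norm of the exceptional part tends to 0 because
    [X <> L_oo], and [c / m] is of order [1 / (phi_X (1 / q) sqrt q)], which is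
    arbitrarily small for suitable [q] by the hypothesis on [phi_X]. *)
Require Import Defs.
From mathcomp Require Import all_boot all_order all_algebra.
From mathcomp Require Import all_classical all_reals all_analysis.
From mathcomp Require Import measurable_realfun ess_sup_inf.
From mathcomp Require Import ring lra zify.
Import Order.TTheory GRing.Theory Num.Theory.
Import numFieldNormedType.Exports.
Local Open Scope classical_set_scope.
Local Open Scope ring_scope.

Set Implicit Arguments.
Unset Strict Implicit.
Unset Printing Implicit Defensive.

(** * Quadratic bounds for the exponential *)

(** Since [(1 - x + x ^+ 2) * (1 + x) = 1 + x ^+ 3], the bound [1 + x <= expR x] suffices. *)
Lemma expRN_le_quadratic (R : realType) (x : R) :
  0 <= x -> expR (- x) <= 1 - x + x ^+ 2.
Proof.
move=> x0; rewrite expRN; have e1 := expR_ge1Dx x.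
have e0 : 0 < expR x by exact: expR_gt0.
rewrite -[leLHS]mul1r ler_pdivrMr //.
apply: (@le_trans _ _ ((1 - x + x ^+ 2) * (1 + x))); first by nra.
by rewrite ler_wpM2l //; nra.
Qed.

(** [1 - x <= expR (- x)] bounds [expR x] by [1 / (1 - x)], and [(1 + x + 2 * x ^+ 2) * (1 - x) = 1
    + x ^+ 2 * (1 - 2 * x) >= 1]. *)
Lemma expR_le_quadratic (R : realType) (x : R) :
  `|x| <= 2^-1 -> expR x <= 1 + x + 2 * x ^+ 2.
Proof.
move=> hx; have /andP[h1 h2] : - 2^-1 <= x <= 2^-1 by rewrite -ler_norml.
have e1 := expR_ge1Dx (- x).
have e0 : 0 < expR x by exact: expR_gt0.
have eM : expR (- x) * expR x = 1 by rewrite -expRD addNr expR0.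
have h : (1 - x) * expR x <= 1 by rewrite -[leRHS]eM ler_wpM2r // ltW.
have hx2 : 0 <= x ^+ 2 by exact: sqr_ge0.
have -> : expR x = ((1 - x) * expR x) / (1 - x) by field; lra.
rewrite ler_pdivrMr; last lra.
apply: (le_trans h).
have : 0 <= x ^+ 2 * (1 - 2 * x) by apply: mulr_ge0 => //; lra.
by rewrite !expr2; lra.
Qed.

(** For [|y| <= 1 / 2] the linear terms of the two quadratic bounds cancel; for larger [|y|] both
    exponents are at most [2 * y ^+ 2]. *)
Lemma cosh_le_expR (R : realType) (y : R) :
  (expR y + expR (- y)) / 2 <= expR (2 * y ^+ 2).
Proof.
have [hy|hy] := lerP `|y| 2^-1.
  have h1 := expR_le_quadratic hy.
  have h2 : expR (- y) <= 1 + - y + 2 * (- y) ^+ 2.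
    by apply: expR_le_quadratic; rewrite normrN.
  have h3 := expR_ge1Dx (2 * y ^+ 2); rewrite sqrrN in h2; lra.
have e : y ^+ 2 = `|y| ^+ 2 by rewrite real_normK ?num_real.
have b : `|y| <= 2 * y ^+ 2 by rewrite e; nra.
have h1 : expR y <= expR (2 * y ^+ 2).
  by rewrite ler_expR (le_trans _ b) // ler_norm.
have h2 : expR (- y) <= expR (2 * y ^+ 2).
  by rewrite ler_expR (le_trans _ b) // -normrN ler_norm.
lra.
Qed.

(** * Moments of random sign sums *)

Section SignSums.
Variables (R : realType) (I : finType).
Implicit Types (z : I -> R) (g : {ffun I -> bool}) (r : seq I).

Definition sign_sum z r g : R := \sum_(i <- r) (-1) ^+ g i * z i.

Definition sq_sum z r : R := \sum_(i <- r) z i ^+ 2.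

Lemma sq_sum_ge0 z r : 0 <= sq_sum z r.
Proof. by apply: sumr_ge0 => i _; exact: sqr_ge0. Qed.

Definition flip (i : I) g : {ffun I -> bool} :=
  [ffun j => if j == i then ~~ g j else g j].

Lemma flipK i : involutive (flip i).
Proof.
by move=> g; apply/ffunP => j; rewrite !ffunE; case: eqP => // _; rewrite negbK.
Qed.

Lemma sign_sum_flip z i r g : i \notin r ->
  sign_sum z r (flip i g) = sign_sum z r g.
Proof.
move=> ir; apply: eq_big_seq => j jr; rewrite ffunE.
by case: eqP => // e; rewrite e (negPf ir) in jr.
Qed.

(* Flipping the coordinate i is an involution of the sign vectors. *)
Lemma sum_sign_sum_cons (h : R -> R) z i r : i \notin r ->
  \sum_g h (sign_sum z (i :: r) g) =
  \sum_g (h (sign_sum z r g + z i) + h (sign_sum z r g - z i)) / 2.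
Proof.
move=> ir.
have e g : h (sign_sum z (i :: r) g) + h (sign_sum z (i :: r) (flip i g)) =
    h (sign_sum z r g + z i) + h (sign_sum z r g - z i).
  rewrite /sign_sum !big_cons -!/(sign_sum _ _ _) sign_sum_flip // ffunE eqxx.
  case: (g i) => /=; rewrite ?expr0 ?expr1 ?mul1r ?mulN1r.
    by rewrite addrC [z i + _]addrC [- z i + _]addrC.
  by rewrite [z i + _]addrC [- z i + _]addrC.
rewrite -mulr_suml; under [in RHS]eq_bigr do rewrite -e.
rewrite big_split /= [X in _ + X](_ : _ = \sum_g h (sign_sum z (i :: r) g));
  last by rewrite [RHS](reindex_inj (inv_inj (flipK i))).
by field.
Qed.

Lemma sum_sign_sum_sqr z r : uniq r ->
  \sum_g sign_sum z r g ^+ 2 = #|{ffun I -> bool}|%:R * sq_sum z r.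
Proof.
elim: r => [_|i r IH /= /andP[ir ur]].
  by rewrite /sq_sum big_nil mulr0 big1 // => g _; rewrite /sign_sum big_nil expr0n.
rewrite (sum_sign_sum_cons (fun x => x ^+ 2)) //.
rewrite (eq_bigr (fun g => sign_sum z r g ^+ 2 + z i ^+ 2)); last first.
  by move=> g _; field.
by rewrite big_split /= IH // sumr_const /sq_sum big_cons -mulr_natl; ring.
Qed.

(** Averaging [(x + a) ^+ 4] over the sign of [a] gives [x ^+ 4 + 6 * a ^+ 2 * x ^+ 2 + a ^+ 4]; the
    constant 3 leaves [2 * a ^+ 4] to spare at each induction step. *)
Lemma sum_sign_sum_pow4 z r : uniq r ->
  \sum_g sign_sum z r g ^+ 4 <= #|{ffun I -> bool}|%:R * (3 * sq_sum z r ^+ 2).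
Proof.
elim: r => [_|i r IH /= /andP[ir ur]].
  rewrite /sq_sum big_nil expr0n mulr0 mulr0 big1 // => g _.
  by rewrite /sign_sum big_nil expr0n.
rewrite (sum_sign_sum_cons (fun x => x ^+ 4)) //.
rewrite (eq_bigr (fun g => sign_sum z r g ^+ 4 +
  (6 * z i ^+ 2 * sign_sum z r g ^+ 2 + z i ^+ 4))); last by move=> g _; field.
rewrite big_split /= big_split /= -mulr_sumr sum_sign_sum_sqr // sumr_const.
have := IH ur; rewrite {3}/sq_sum big_cons -/(sq_sum z r) -mulr_natl.
set C := _%:R; set s := sq_sum z r; set a := z i => h.
have C0 : 0 <= C by exact: ler0n.
have : 0 <= C * (2 * a ^+ 4) by rewrite mulr_ge0 // mulr_ge0 // exprn_even_ge0.
by rewrite !exprS !expr0; lra.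
Qed.

(** Induction on the coordinates: averaging over the sign of [z i] produces a hyperbolic cosine,
    which [cosh_le_expR] absorbs into a larger parameter [l]. The denominator
    [1 - 8 * (l * sq_sum z r)] pays for this growth. *)
Lemma sum_expR_sign_sum_sqr z r (l : R) : uniq r -> 0 <= l ->
  8 * (l * sq_sum z r) < 1 ->
  \sum_g expR (l * sign_sum z r g ^+ 2) <=
  #|{ffun I -> bool}|%:R *
    expR (l * sq_sum z r / (1 - 8 * (l * sq_sum z r))).
Proof.
elim: r l => [|i r IH] l /=.
  move=> _ l0 _; rewrite /sq_sum big_nil mulr0 mul0r expR0 mulr1.
  rewrite (eq_bigr (fun=> 1)) ?sumr_const // => g _.
  by rewrite /sign_sum big_nil expr0n mulr0 expR0.
move=> /andP[ir ur] l0; rewrite /sq_sum big_cons -/(sq_sum z r).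
set s := sq_sum z r; set a := z i => hl.
have s0 : 0 <= s by exact: sq_sum_ge0.
have a0 : 0 <= a ^+ 2 by exact: sqr_ge0.
have ls0 : 0 <= l * s by exact: mulr_ge0.
have la0 : 0 <= l * a ^+ 2 by exact: mulr_ge0.
rewrite (sum_sign_sum_cons (fun x => expR (l * x ^+ 2))) //.
pose l' := l + 8 * l ^+ 2 * a ^+ 2.
have l'0 : 0 <= l' by rewrite addr_ge0 // mulr_ge0 // mulr_ge0 // sqr_ge0.
have hD : 0 < 1 - 8 * (l * a ^+ 2) by lra.
(* For [l > 0] this reads [1 / l' >= 1 / l - 8 * a ^+ 2]: the loss in the inverse of the parameter
   is additive over the coordinates. *)
have hl' : l' * (1 - 8 * (l * a ^+ 2)) <= l.
  have : 0 <= l * (l * a ^+ 2) ^+ 2 by rewrite mulr_ge0 // sqr_ge0.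
  by rewrite /l' !expr2; lra.
have hls : l' * s * (1 - 8 * (l * a ^+ 2)) <= l * s.
  by rewrite mulrAC ler_wpM2r.
have l's0 : 0 <= l' * s by exact: mulr_ge0.
have hl's : 8 * (l' * s) < 1.
  rewrite -(ltr_pM2r hD); lra.
apply: (@le_trans _ _ (\sum_g expR (l * a ^+ 2) *
    expR (l' * sign_sum z r g ^+ 2))).
  apply: ler_sum => g _; set x := sign_sum z r g.
  have -> : expR (l * a ^+ 2) * expR (l' * x ^+ 2) =
      expR (l * (x ^+ 2 + a ^+ 2)) * expR (2 * (2 * l * x * a) ^+ 2).
    by rewrite -!expRD; congr expR; rewrite /l'; ring.
  have -> : (expR (l * (x + a) ^+ 2) + expR (l * (x - a) ^+ 2)) / 2 =
      expR (l * (x ^+ 2 + a ^+ 2)) *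
        ((expR (2 * l * x * a) + expR (- (2 * l * x * a))) / 2).
    by rewrite mulrA mulrDr -!expRD; congr ((expR _ + expR _) / 2); ring.
  by rewrite ler_wpM2l ?expR_ge0 // cosh_le_expR.
rewrite -mulr_sumr.
apply: (le_trans (ler_wpM2l (expR_ge0 _) (IH l' ur l'0 hl's))).
rewrite mulrCA ler_wpM2l ?ler0n // -expRD ler_expR -/s.
have hD2 : 0 < 1 - 8 * (l * (a ^+ 2 + s)) by rewrite mulrDr; lra.
have hD3 : 0 < 1 - 8 * (l' * s) by lra.
apply: (@le_trans _ _ (l * a ^+ 2 / (1 - 8 * (l * (a ^+ 2 + s))) +
   l * s / (1 - 8 * (l * (a ^+ 2 + s))))); last first.
  by rewrite -mulrDl -mulrDr.
apply: lerD.
  rewrite ler_pdivlMr // -[leRHS]mulr1 ler_wpM2l //; lra.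
rewrite ler_pdivrMr // mulrAC ler_pdivlMr //; lra.
Qed.

(** A two-sided exponential moment bound for [q g ^+ 2] around its mean [s]. The upper deviation
    comes from the exponential moment of the square, the lower one from the second and fourth
    moments of [q g]. *)
Lemma sum_expR_dev_le z (l : R) (s := \sum_i z i ^+ 2)
    (q := fun g => \sum_i (-1) ^+ g i * z i) : 0 <= l -> 16 * (l * s) <= 1 ->
  \sum_g expR (l * (q g ^+ 2 - s)) <=
    #|{ffun I -> bool}|%:R * expR (16 * (l * s) ^+ 2) /\
  \sum_g expR (l * (s - q g ^+ 2)) <=
    #|{ffun I -> bool}|%:R * expR (16 * (l * s) ^+ 2).
Proof.
move=> l0 hl.
have s0 : 0 <= s by apply: sumr_ge0 => i _; exact: sqr_ge0.
have ls0 : 0 <= l * s by exact: mulr_ge0.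
have eq g : q g = sign_sum z (index_enum I) g by [].
have es : s = sq_sum z (index_enum I) by [].
have uI : uniq (index_enum I) by exact: index_enum_uniq.
split.
  under eq_bigr do rewrite mulrBr expRD.
  rewrite -mulr_suml; under eq_bigr do rewrite eq.
  have h8 : 8 * (l * s) < 1 by lra.
  have := sum_expR_sign_sum_sqr uI l0 h8; rewrite -es => h.
  apply: (le_trans (ler_wpM2r (expR_ge0 _) h)).
  set C := _%:R; set u := l * s in ls0 hl h8 *.
  rewrite -[leLHS]mulrA; apply: ler_wpM2l; first exact: ler0n.
  rewrite -expRD ler_expR lerBlDr ler_pdivrMr; last by lra.
  have : 0 <= u ^+ 2 * (1 - 16 * u) by rewrite mulr_ge0 ?sqr_ge0 //; lra.
  by rewrite !expr2; lra.
apply: (@le_trans _ _ (\sum_g expR (l * s) *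
   (1 - l * q g ^+ 2 + l ^+ 2 * q g ^+ 4))).
  apply: ler_sum => g _; rewrite mulrBr expRD ler_wpM2l ?expR_ge0 //.
  rewrite (_ : l ^+ 2 * _ = (l * q g ^+ 2) ^+ 2); last by ring.
  by apply: expRN_le_quadratic; rewrite mulr_ge0 // sqr_ge0.
rewrite -mulr_sumr !big_split /= sumr_const -[_ *+ _]mulr_natl sumrN -!mulr_sumr.
under eq_bigr do rewrite eq.
under [X in _ + _ * X]eq_bigr do rewrite eq.
rewrite sum_sign_sum_sqr // -es.
have := sum_sign_sum_pow4 z uI; rewrite -es; set C := _%:R => h4.
have C0 : 0 <= C by exact: ler0n.
have l2 : 0 <= l ^+ 2 by exact: sqr_ge0.
apply: (@le_trans _ _ (expR (l * s) * (C * (1 - l * s + 3 * (l * s) ^+ 2)))).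
  rewrite ler_wpM2l ?expR_ge0 //; have := ler_wpM2l l2 h4.
  by rewrite !expr2; lra.
rewrite mulr1 [leLHS]mulrCA ler_wpM2l //.
have h := expR_ge1Dx (- (l * s) + 3 * (l * s) ^+ 2).
apply: (@le_trans _ _ (expR (l * s) * expR (- (l * s) + 3 * (l * s) ^+ 2))).
  by rewrite ler_wpM2l ?expR_ge0 //; lra.
rewrite -expRD ler_expR; have := sqr_ge0 (l * s); lra.
Qed.

End SignSums.


(** * Counting integer points in a ball *)

Lemma sum_geometric_le (R : realType) (b : R) K : 0 <= b -> b <= 2^-1 ->
  \sum_(j < K) b ^+ j.+1 <= 2 * b.
Proof.
move=> b0 b2.
suff : \sum_(j < K) b ^+ j.+1 <= 2 * b * (1 - b ^+ K).
  move/le_trans; apply.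
  have : 0 <= 2 * b * b ^+ K by rewrite mulr_ge0 ?exprn_ge0 // mulr_ge0.
  lra.
elim: K => [|K IH]; first by rewrite big_ord0 expr0 subrr mulr0.
rewrite big_ord_recr /=; move: IH; rewrite exprS; set x := b ^+ K.
have x0 : 0 <= x by exact: exprn_ge0.
have : 0 <= b * x * (1 - 2 * b) by rewrite mulr_ge0 ?mulr_ge0 //; lra.
lra.
Qed.

(** Indexes the integers from [- K] to [K] by a finite type, so that integer vectors can be counted;
    the form [K + K.+1] lets [big_split_ord] separate the negative values. *)
Definition centered K (j : 'I_(K + K.+1)) : int := j%:Z - K%:Z.

Lemma centered_surj K (x : int) : (`|x| <= K)%N -> exists j, @centered K j = x.
Proof.
move=> hx; have h : (`|(x + K%:Z)%R| < K + K.+1)%N by lia.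
by exists (Ordinal h); rewrite /centered /=; lia.
Qed.

Lemma sum_pow_centered_le (R : realType) (b : R) K : 0 <= b -> b <= 2^-1 ->
  \sum_j b ^+ `|@centered K j|%N <= 1 + 4 * b.
Proof.
move=> b0 b2; rewrite big_split_ord /= big_ord_recl /=.
have -> : \sum_(i < K) b ^+ `|centered (lshift K.+1 i)|%N =
    \sum_(j < K) b ^+ j.+1.
  rewrite (reindex_inj rev_ord_inj) /=; apply: eq_bigr => i _.
  by congr (_ ^+ _); rewrite /centered /=; have := ltn_ord i; lia.
have -> : \sum_(i < K) b ^+ `|centered (rshift K (lift ord0 i))|%N =
    \sum_(j < K) b ^+ j.+1.
  by apply: eq_bigr => i _; congr (_ ^+ _); rewrite /centered /= /bump; lia.
rewrite (_ : `|_|%N = 0%N) ?expr0; last by rewrite /centered /=; lia.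
have := sum_geometric_le K b0 b2; lra.
Qed.

Lemma normz_le_sqr (x : int) : (`|x|%N%:Z <= x ^+ 2)%R.
Proof.
rewrite -[x ^+ 2]real_normK ?num_real // -abszE.
case: `|x|%N => [|n]; first by rewrite expr0n.
by rewrite expr2; nia.
Qed.

Lemma sum_sqr_norm_le (I : finType) (z : I -> int) (K : nat) :
  \sum_i z i ^+ 2 <= K%:Z -> forall i, (`|z i| <= K)%N.
Proof.
move=> hz i; rewrite -lez_nat; apply: le_trans hz.
apply: le_trans (normz_le_sqr _) _.
by rewrite (bigD1 i) //= lerDl sumr_ge0 // => j _; exact: sqr_ge0.
Qed.

(* Weight each lattice point by a^(K - |z|_1): this is at least 1 on the ball. *)
Lemma card_lattice_ball_le (R : realType) (I : finType) (K : nat) (a : R) :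
  2 <= a ->
  #|[set z : {ffun I -> 'I_(K + K.+1)} | \sum_i centered (z i) ^+ 2 <= K%:Z]%SET|%:R
  <= a ^+ K * (1 + 4 / a) ^+ #|I|.
Proof.
move=> a2; have a0 : 0 < a by lra.
have b0 : 0 <= a^-1 by rewrite invr_ge0 ltW.
have b2 : a^-1 <= 2^-1 by rewrite lef_pV2 ?posrE.
apply: (@le_trans _ _ (\sum_(z : {ffun I -> 'I_(K + K.+1)})
   a ^+ K * \prod_i (a^-1) ^+ `|centered (z i)|%N)).
  rewrite -sum1_card natr_sum big_mkcond /=; apply: ler_sum => z _.
  have p0 : 0 <= a ^+ K * \prod_i (a^-1) ^+ `|centered (z i)|%N.
    apply: mulr_ge0; first by rewrite exprn_ge0 // ltW.
    by apply: prodr_ge0 => i _; exact: exprn_ge0.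
  case: ifPn => //; rewrite inE => hz.
  have hK : (\sum_i `|centered (z i)| <= K)%N.
    rewrite -lez_nat; apply: le_trans hz.
    rewrite -[leLHS]natz natr_sum; apply: ler_sum => i _.
    by rewrite natz normz_le_sqr.
  rewrite -expr_sum; move: hK; set k := (\sum_i _)%N => hK.
  rewrite -[X in a ^+ X](subnK hK) exprD -mulrA -exprMn divff ?gt_eqF //.
  by rewrite expr1n mulr1 exprn_ege1 //; lra.
rewrite -mulr_sumr ler_wpM2l ?exprn_ge0 ?(ltW a0) //.
rewrite -(bigA_distr_bigA (fun=> fun j => (a^-1) ^+ `|@centered K j|%N)) /=.
rewrite prodr_const; apply: lerXn2r; rewrite ?nnegrE ?sum_pow_centered_le //.
  by apply: sumr_ge0 => j _; exact: exprn_ge0.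
by rewrite addr_ge0 // mulr_ge0.
Qed.

(** * Random sign matrices are almost isometric on short integer vectors *)

Definition row_dot (R : realType) (I : finType) (g : {ffun I -> bool})
  (z : I -> int) : R := \sum_i (-1) ^+ g i * (z i)%:~R.

Definition sqnorm (R : realType) (I : finType) (z : I -> int) : R :=
  \sum_i (z i)%:~R ^+ 2.

Lemma sqnormE (R : realType) (I : finType) (z : I -> int) :
  sqnorm R z = (\sum_i z i ^+ 2)%:~R.
Proof.
by rewrite [RHS]rmorph_sum /=; apply: eq_bigr => i _; rewrite rmorphXn.
Qed.

Lemma sqnorm_ge0 (R : realType) (I : finType) (z : I -> int) : 0 <= sqnorm R z.
Proof. by apply: sumr_ge0 => i _; exact: sqr_ge0. Qed.

(** This is [||G z||^2] for the sign matrix with rows [G k]; its mean over all [G] is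
    [#|J|%:R * sqnorm R z]. *)
Definition sq_image (R : realType) (I J : finType)
    (G : {ffun J -> {ffun I -> bool}}) (z : I -> int) : R :=
  \sum_k row_dot R (G k) z ^+ 2.

(** The rows of [G] range independently, so the sum over matrices factors into [#|J|] copies of the
    one-row bound [sum_expR_dev_le]. *)
Lemma sum_expR_sq_image_le (R : realType) (I J : finType) (z : I -> int) (l : R)
    (s := sqnorm R z) : 0 <= l -> 16 * (l * s) <= 1 ->
  \sum_(G : {ffun J -> {ffun I -> bool}})
    (expR (l * (sq_image R G z - #|J|%:R * s)) +
     expR (l * (#|J|%:R * s - sq_image R G z))) <=
  #|{ffun J -> {ffun I -> bool}}|%:R * (2 * expR (16 * (l * s) ^+ 2 * #|J|%:R)).
Proof.
move=> l0 hl.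
have [h1 h2] := sum_expR_dev_le (z := fun i => (z i)%:~R) l0 hl.
rewrite big_split /= [2 * _]mulr_natl mulr2n mulrDr.
have aux (h : {ffun I -> bool} -> R) :
    \sum_g expR (h g) <= #|{ffun I -> bool}|%:R * expR (16 * (l * s) ^+ 2) ->
    \sum_(G : {ffun J -> {ffun I -> bool}}) expR (\sum_k h (G k)) <=
    #|{ffun J -> {ffun I -> bool}}|%:R * expR (16 * (l * s) ^+ 2 * #|J|%:R).
  move=> hh; under eq_bigr do rewrite expR_sum.
  rewrite -(bigA_distr_bigA (fun=> fun g => expR (h g))) /= prodr_const.
  rewrite expRM_natr card_ffun natrX -exprMn.
  apply: lerXn2r; rewrite ?nnegrE //.
  by apply: sumr_ge0 => g _; exact: expR_ge0.
apply: lerD.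
  apply: le_trans (aux _ h1); apply: ler_sum => G _.
  rewrite ler_expR -mulr_sumr sumrB sumr_const.
  by rewrite mulr_natl.
apply: le_trans (aux _ h2); apply: ler_sum => G _.
rewrite ler_expR -mulr_sumr sumrB sumr_const.
by rewrite mulr_natl.
Qed.

(** Union bound by exponential moments. If each matrix failed at some integer point of the ball, the
    deviation terms summed over all matrices and points would be at least [expR (l * t)] per matrix,
    whereas the moment bound times the number of points is smaller by hypothesis. *)
Lemma exists_almost_isometry (R : realType) (I J : finType) (K : nat)
    (l a t : R) : 0 <= l -> 16 * (l * K%:R) <= 1 -> 2 <= a ->
  a ^+ K * (1 + 4 / a) ^+ #|I| * (2 * expR (16 * (l * K%:R) ^+ 2 * #|J|%:R)) <
    expR (l * t) ->
  exists G : {ffun J -> {ffun I -> bool}}, forall z : I -> int,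
    \sum_i z i ^+ 2 <= K%:Z ->
    `|sq_image R G z - #|J|%:R * sqnorm R z| <= t.
Proof.
move=> l0 hl a2 hlt; apply: contrapT => hG.
pose S := [set z : {ffun I -> 'I_(K + K.+1)} | \sum_i centered (z i) ^+ 2 <= K%:Z]%SET.
pose E (G : {ffun J -> {ffun I -> bool}}) (z : {ffun I -> 'I_(K + K.+1)}) : R :=
  let w := fun i => centered (z i) in
  expR (l * (sq_image R G w - #|J|%:R * sqnorm R w)) +
  expR (l * (#|J|%:R * sqnorm R w - sq_image R G w)).
pose C : R := #|{ffun J -> {ffun I -> bool}}|%:R.
have C0 : 0 < C by rewrite ltr0n; apply/card_gt0P; exists [ffun=> [ffun=> true]].
have low : C * expR (l * t) <= \sum_G \sum_(z in S) E G z.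
  rewrite /C -sum1_card natr_sum mulr_suml; apply: ler_sum => G _.
  rewrite mul1r; have : exists z : I -> int, \sum_i z i ^+ 2 <= K%:Z /\
      t < `|sq_image R G z - #|J|%:R * sqnorm R z|.
    apply: contrapT => hn; apply: hG; exists G => z hz.
    by rewrite leNgt; apply/negP => ht; apply: hn; exists z.
  move=> [z [hz ht]].
  have hc i : exists j, @centered K j = z i.
    by apply: centered_surj; exact: sum_sqr_norm_le.
  have [w hw] := choice hc.
  have wz : (fun i => centered ([ffun i => w i] i)) = z.
    by apply/funext => i; rewrite ffunE.
  have wS : [ffun i => w i] \in S.
    by rewrite inE; under eq_bigr do rewrite ffunE hw.
  rewrite (bigD1 _ wS) {1}/E /= wz -[leLHS]addr0; apply: lerD; last first.
    by apply: sumr_ge0 => ? _; rewrite addr_ge0 // expR_ge0.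
  move: ht; rewrite ltr_normr => /orP[ht|ht].
    rewrite -[leLHS]addr0; apply: lerD; last exact: expR_ge0.
    by rewrite ler_expR ler_wpM2l // ltW.
  rewrite -[leLHS]add0r; apply: lerD; first exact: expR_ge0.
  by rewrite ler_expR ler_wpM2l // -[leRHS]opprB ltW // opprB -opprB.
have up : \sum_G \sum_(z in S) E G z <=
   C * (a ^+ K * (1 + 4 / a) ^+ #|I| * (2 * expR (16 * (l * K%:R) ^+ 2 * #|J|%:R))).
  rewrite exchange_big /=.
  apply: (@le_trans _ _ (\sum_(z in S) C * (2 * expR (16 * (l * K%:R) ^+ 2 * #|J|%:R)))).
    apply: ler_sum => z; rewrite inE => hz.
    have hs : sqnorm R (fun i => centered (z i)) <= K%:R.
      by rewrite sqnormE -[K%:R]/(K%:Z%:~R) ler_int.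
    have s0 := sqnorm_ge0 R (fun i => centered (z i)).
    have hls : l * sqnorm R (fun i => centered (z i)) <= l * K%:R by rewrite ler_wpM2l.
    apply: le_trans (sum_expR_sq_image_le J l0 _) _; first lra.
    rewrite ler_wpM2l ?ler0n // ler_wpM2l // ler_expR ler_wpM2r // ler_wpM2l //.
    by rewrite lerXn2r // nnegrE mulr_ge0.
  rewrite sumr_const -[leLHS]mulr_natl mulrCA ler_wpM2l ?(ltW C0) //.
  by rewrite ler_wpM2r ?card_lattice_ball_le // mulr_ge0 // expR_ge0.
have := le_trans low up; rewrite ler_pM2l // => /(lt_le_trans hlt).
by rewrite ltxx.
Qed.


Lemma exists_almost_isometry_params (R : realType) (gamma : R) : 0 < gamma ->
  exists2 p : nat, (0 < p)%N & \forall B \near \oo, forall I : finType,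
  #|I| = (p * B)%N -> exists G : {ffun 'I_(Num.truncn (gamma * #|I|%:R)) ->
    {ffun I -> bool}}, forall z : I -> int,
    \sum_i z i ^+ 2 <= (4 * B)%:Z ->
    `|sq_image R G z - (Num.truncn (gamma * #|I|%:R))%:R * sqnorm R z| <=
      (Num.truncn (gamma * #|I|%:R))%:R * B%:R / 8.
Proof.
move=> g0.
(* With e = 4096 and exponential parameter 1 / (e B), the moment loss
   16 (4 / e)^2 = 1 / (16 e) is half of the tail gain 1 / (8 e). *)
have [e e0 he] : exists2 e : R, 256 <= e & 256 / e = 16^-1.
  exists (256 * 16); first lra.
  by rewrite invfM mulrA divff ?mul1r // pnatr_eq0.
(* Up to rounding, [d * p * B] is the gain left after the moment loss. First [a], then [p] is taken
   so large that the two exponents of the lattice count, [4 / a * (p * B)] and [a * (4 * B)], use at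
   most a quarter of it each; [4 <= d * B] covers the rounding and the factor 2. *)
pose d := gamma / (16 * e).
have d0 : 0 < d by rewrite divr_gt0 //; lra.
pose a := 16 / d + 2; have a2 : 2 <= a by rewrite lerDr divr_ge0 // ltW.
have a0 : 0 < a by lra.
have ad : 16 <= d * a.
  by rewrite /a mulrDr mulrCA divff ?gt_eqF // mulr1; lra.
pose p := (Num.truncn (16 * a / d)).+1.
have pd : 16 * a <= d * p%:R.
  by rewrite [d * _]mulrC -ler_pdivrMr // ltW // /p truncnS_gt.
exists p => //; near=> B => I cI.
have B1 : (1 <= B)%N by near: B; exists 1%N.
have Bd : 4 <= d * B%:R.
  rewrite mulrC -ler_pdivrMr //; near: B; exact: nbhs_infty_ger.
set n := Num.truncn _.
have B0 : 0 < B%:R :> R by rewrite ltr0n.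
have hn : gamma * (p%:R * B%:R) - 1 < n%:R.
  by rewrite ltrBlDr natr1 -natrM -cI truncnS_gt.
have [|||| G hG] := @exists_almost_isometry R I 'I_n (4 * B) (e * B%:R)^-1 a
    (n%:R * B%:R / 8).
- by rewrite invr_ge0 mulr_ge0 //; lra.
- have -> : 16 * ((e * B%:R)^-1 * (4 * B)%:R) = 4^-1 * (256 / e) :> R.
    by rewrite natrM; field; lra.
  by rewrite he; lra.
- by [].
- rewrite card_ord cI.
  have -> : (e * B%:R)^-1 * (n%:R * B%:R / 8) = n%:R / (8 * e) :> R.
    by field; lra.
  have -> : 16 * ((e * B%:R)^-1 * (4 * B)%:R) ^+ 2 * n%:R = n%:R / (16 * e) :> R.
    rewrite natrM; have -> : n%:R / (16 * e) = 256 / e * (n%:R / e) :> R.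
      by rewrite he; field; lra.
    by field; lra.
  have h2 : 2 <= expR 1 :> R by have := expR_ge1Dx (1 : R); lra.
  have ha : a ^+ (4 * B) <= expR (a * (4 * B)%:R).
    rewrite expRM_natr; apply: lerXn2r; rewrite ?nnegrE ?expR_ge0 ?(ltW a0) //.
    by have := expR_ge1Dx a; lra.
  have hb : (1 + 4 / a) ^+ (p * B) <= expR (4 / a * (p * B)%:R).
    rewrite expRM_natr; apply: lerXn2r; rewrite ?nnegrE ?expR_ge0 ?expR_ge1Dx //.
    by rewrite addr_ge0 // divr_ge0 // ltW.
  apply: (@le_lt_trans _ _ (expR (a * (4 * B)%:R) * expR (4 / a * (p * B)%:R) *
     (expR 1 * expR (n%:R / (16 * e))))).
    apply: ler_pM => //.
    + apply: mulr_ge0; apply: exprn_ge0; first exact: ltW.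
      by rewrite addr_ge0 // divr_ge0 // ltW.
    + apply: ler_pM => //; apply: exprn_ge0; first exact: ltW.
      by rewrite addr_ge0 // divr_ge0 // ltW.
    + by rewrite ler_wpM2r // expR_ge0.
  rewrite -!expRD ltr_expR !natrM.
  have h1 : a * (4 * B%:R) <= d * p%:R * B%:R / 4.
    have := ler_wpM2r (ltW B0) pd; lra.
  have h3 : 4 / a * (p%:R * B%:R) <= d * p%:R * B%:R / 4.
    rewrite mulrAC ler_pdivrMr //.
    have : 0 <= p%:R * B%:R * (d * a - 16) by rewrite mulr_ge0 ?subr_ge0 // mulr_ge0.
    lra.
  have -> : n%:R / (8 * e) = n%:R / (16 * e) + n%:R / (16 * e) :> R.
    by field; lra.
  have h4 : d * p%:R * B%:R - 1 < n%:R / (16 * e).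
    rewrite ltr_pdivlMr; last lra.
    apply: le_lt_trans hn; rewrite mulrBl mul1r.
    have -> : d * p%:R * B%:R * (16 * e) = gamma * (p%:R * B%:R).
      by rewrite /d; field; lra.
    lra.
  have h5 : 4 <= d * p%:R * B%:R.
    apply: (le_trans Bd); rewrite [leRHS]mulrAC ler_peMr ?ler1n //.
    by rewrite mulr_ge0 ?(ltW d0).
  lra.
by exists G; rewrite card_ord in hG.
Unshelve. all: by end_near. Qed.

(** * Approximation of short integer vectors by the row space *)

(** [w] is [x] rounded towards zero; the second inequality is the form in which [exists_shrunk] uses
    this. *)
Lemma exists_trunc (R : realType) (x : R) :
  exists w : int, `|x - w%:~R| <= 1 /\ w%:~R ^+ 2 <= w%:~R * x.
Proof.
wlog x0 : x / 0 <= x => [hw|].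
  have [/hw//|/ltW x0] := leP 0 x.
  have [|w [h1 h2]] := hw (- x); first by rewrite oppr_ge0.
  exists (- w); rewrite mulrNz sqrrN mulNr -mulrN; split=> //.
  by rewrite -normrN opprB addrC.
exists (Num.floor x); have h1 := floor_le x.
have h2 := floorD1_gt x; rewrite intrD in h2.
have f0 : 0 <= (Num.floor x)%:~R :> R by rewrite ler0z floor_ge0.
split; first by rewrite ger0_norm; lra.
by rewrite expr2 ler_wpM2l.
Qed.

Lemma sum_sqr_shrink (I : finType) (w : I -> int) (i : I) :
  w i != 0 -> \sum_j (if j == i then w i - sgz (w i) else w j) ^+ 2 =
  \sum_j w j ^+ 2 - (2 * `|w i| - 1).
Proof.
move=> wi; rewrite (bigD1 i) //= eqxx [in RHS](bigD1 i) //=.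
rewrite (eq_bigr (fun j => w j ^+ 2)); last by move=> j /negPf ->.
by case: sgzP wi => // _ _; ring.
Qed.

(* [w i ^+ 2 <= w i * x i] says that w i lies between 0 and x i; peeling off one
   unit at a time never divides the square norm by more than 4 once it exceeds B. *)
Lemma exists_shrunk (R : realType) (I : finType) (x : I -> R) (B : nat)
    (w : I -> int) : (0 < B)%N ->
  (forall i, (w i)%:~R ^+ 2 <= (w i)%:~R * x i) -> B%:Z < 4 * \sum_i w i ^+ 2 ->
  exists v : I -> int, [/\ forall i, (v i)%:~R ^+ 2 <= (v i)%:~R * x i,
    B%:Z < 4 * \sum_i v i ^+ 2 & \sum_i v i ^+ 2 <= B%:Z].
Proof.
move=> B0; have [m] := ubnP (\sum_i `|w i|)%N; elim: m w => // m IH w hm hw hB.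
have [hs|hs] := leP (\sum_i w i ^+ 2) B%:Z; first by exists w.
have [i wi] : exists i, w i != 0.
  apply: contrapT => hn; move: hs; rewrite big1 ?ltNge // => i _.
  by apply/eqP; rewrite expf_eq0 /=; apply: contrapT => h; apply: hn; exists i; apply/negP.
pose v j := if j == i then w i - sgz (w i) else w j.
have ev : \sum_j v j ^+ 2 = \sum_j w j ^+ 2 - (2 * `|w i| - 1).
  exact: sum_sqr_shrink.
have wW : w i ^+ 2 <= \sum_j w j ^+ 2.
  by rewrite [leRHS](bigD1 i) //= lerDl sumr_ge0 // => j _; exact: sqr_ge0.
apply: (IH v).
- apply: leq_trans (_ : (\sum_j `|v j| < \sum_j `|w j|)%N) _; last by [].
  rewrite (bigD1 i) //= [in ltnRHS](bigD1 i) //= /v eqxx.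
  rewrite (eq_bigr (fun j => `|w j|%N)); last by move=> j /negPf ->.
  by rewrite ltn_add2r; case: sgzP wi => //; lia.
- move=> j; rewrite /v; case: eqP => [->|_]; last exact: hw.
  have := hw i; case: sgzP wi => // h _; rewrite intrD ?mulrNz mulr1z.
    have h1 : 1 <= (w i)%:~R :> R by rewrite ler1z; lia.
    rewrite expr2 ler_pM2l; last lra.
    by move=> h2; rewrite expr2; apply: ler_wpM2l; lra.
  have h1 : (w i)%:~R <= - 1 :> R.
    by rewrite -[- 1]/((-1)%:~R) ler_int; lia.
  rewrite expr2 ler_nM2l; last lra.
  by move=> h2; rewrite expr2 ?opprK; apply: ler_wnM2l; lra.
rewrite ev; move: hs wW; set W := \sum_j _; rewrite -[w i ^+ 2]real_normK ?num_real //.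
have : 1 <= `|w i| by lia.
set b := `|w i| => b1 hs wW.
(* For [b >= 2], [2 * b - 1] is at most three quarters of [b ^+ 2 <= W], so at least a quarter of
   [W > B] survives; for [b = 1] only 1 is lost, and [W > B >= 1]. *)
have [b2|b2] := leP 2 b; last by rewrite (_ : b = 1); lia.
by nia.
Qed.

Lemma row_dotD (R : realType) (I : finType) (g : {ffun I -> bool}) (z w : I -> int) :
  row_dot R g (fun i => z i + w i) = row_dot R g z + row_dot R g w.
Proof. by rewrite -big_split /=; apply: eq_bigr => i _; rewrite intrD mulrDr. Qed.

Lemma row_dotB (R : realType) (I : finType) (g : {ffun I -> bool}) (z w : I -> int) :
  row_dot R g (fun i => z i - w i) = row_dot R g z - row_dot R g w.
Proof. by rewrite -sumrB /=; apply: eq_bigr => i _; rewrite intrB mulrBr. Qed.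

Section Decoding.
Variables (R : realType) (I J : finType) (G : {ffun J -> {ffun I -> bool}}).
Variable B : nat.
Hypotheses (J0 : (0 < #|J|)%N) (B0 : (0 < B)%N).
Hypothesis almost_isometry : forall z : I -> int, \sum_i z i ^+ 2 <= (4 * B)%:Z ->
  `|sq_image R G z - #|J|%:R * sqnorm R z| <= #|J|%:R * B%:R / 8.

(** Polarization: by the parallelogram law both [z + w] and [z - w] have square norm at most
    [4 * B], so almost isometry applies to each. The two errors add up to
    [2 * (B / 8) / 4 = B / 16]. *)
Lemma residual_dot_le (z w : I -> int) : \sum_i z i ^+ 2 <= B%:Z ->
  \sum_i w i ^+ 2 <= B%:Z ->
  \sum_i (w i)%:~R * (z i)%:~R
    - (\sum_k row_dot R (G k) z * row_dot R (G k) w) / #|J|%:R <= B%:R / 16.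
Proof.
move=> hz hw; have n0 : 0 < #|J|%:R :> R by rewrite ltr0n.
have sqD : \sum_i (z i + w i) ^+ 2 + \sum_i (z i - w i) ^+ 2 =
    2 * \sum_i z i ^+ 2 + 2 * \sum_i w i ^+ 2.
  by rewrite !mulr_sumr -!big_split /=; apply: eq_bigr => i _; ring.
have p1 : 0 <= \sum_i (z i + w i) ^+ 2 by apply: sumr_ge0 => i _; exact: sqr_ge0.
have p2 : 0 <= \sum_i (z i - w i) ^+ 2 by apply: sumr_ge0 => i _; exact: sqr_ge0.
have h1 : \sum_i (z i + w i) ^+ 2 <= (4 * B)%:Z by lia.
have h2 : \sum_i (z i - w i) ^+ 2 <= (4 * B)%:Z by lia.
have {h1} := almost_isometry h1; have {h2} := almost_isometry h2.
rewrite !ler_norml => /andP[_ h2] /andP[h1 _].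
have eG : \sum_k row_dot R (G k) z * row_dot R (G k) w =
   (sq_image R G (fun i => z i + w i) - sq_image R G (fun i => z i - w i)) / 4.
  rewrite -sumrB mulr_suml; apply: eq_bigr => k _.
  by rewrite row_dotD row_dotB; field.
have eI : \sum_i (w i)%:~R * (z i)%:~R =
   (sqnorm R (fun i => z i + w i) - sqnorm R (fun i => z i - w i)) / 4.
  rewrite -sumrB mulr_suml; apply: eq_bigr => i _.
  by rewrite intrD intrB; field.
rewrite eG eI -subr_ge0 -(pmulr_rge0 _ n0).
move: h1 h2; set u := sq_image _ _ (fun i => z i + w i).
set v := sq_image _ _ (fun i => z i - w i).
set s := sqnorm _ (fun i => z i + w i); set t := sqnorm _ (fun i => z i - w i).
move=> h1 h2.
rewrite (_ : _ * _ = (#|J|%:R * B%:R / 4 - (#|J|%:R * s - #|J|%:R * t) + (u - v)) / 4); last first.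
  by field; rewrite gt_eqF.
lra.
Qed.

(** With [n = #|J|], [y] is [G z / n] and [w] rounds twice the residual [r] towards zero. If [w] had
    square norm above [B], some [v] between 0 and [2 r] would satisfy
    [B / 4 < ||v||^2 <= 2 <v, r> <= B / 8]. *)
Lemma decode_step (z : I -> int) : \sum_i z i ^+ 2 <= B%:Z ->
  exists (y : J -> R) (w : I -> int), \sum_i w i ^+ 2 <= B%:Z /\
    forall i, `|(z i)%:~R - \sum_k y k * (-1) ^+ G k i - (w i)%:~R / 2| <= 2^-1.
Proof.
move=> hz; have n0 : 0 < #|J|%:R :> R by rewrite ltr0n.
pose y k := row_dot R (G k) z / #|J|%:R.
pose r i := (z i)%:~R - \sum_k y k * (-1) ^+ G k i.
have [w hw] := choice (fun i => exists_trunc (2 * r i)).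
exists y, w; split; last first.
  move=> i; have [h _] := hw i; move: h; rewrite -/(r i).
  have -> : r i - (w i)%:~R / 2 = (2 * r i - (w i)%:~R) / 2 by field.
  rewrite normrM [ `|2^-1|]ger0_norm //; lra.
rewrite leNgt; apply/negP => hB.
have hB4 : B%:Z < 4 * \sum_i w i ^+ 2.
  by apply: (lt_le_trans hB); rewrite ler_peMl // ltW // (lt_trans _ hB).
have [v [hv hv1 hv2]] := exists_shrunk B0 (fun i => (hw i).2) hB4.
have := residual_dot_le hz hv2.
have -> : \sum_i (v i)%:~R * (z i)%:~R -
    (\sum_k row_dot R (G k) z * row_dot R (G k) v) / #|J|%:R =
    \sum_i (v i)%:~R * r i.
  under [RHS]eq_bigr do rewrite /r mulrBr mulr_sumr.
  rewrite sumrB exchange_big /= mulr_suml; congr (_ - _).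
  apply: eq_bigr => k _; rewrite {2}/row_dot mulr_sumr mulr_suml.
  by apply: eq_bigr => i _; rewrite /y; field; rewrite gt_eqF.
have hs : sqnorm R v <= 2 * \sum_i (v i)%:~R * r i.
  rewrite mulr_sumr; apply: ler_sum => i _; apply: (le_trans (hv i)).
  by rewrite mulrCA.
have hs2 : B%:R < 4 * sqnorm R v.
  by rewrite sqnormE -[B%:R]/(B%:Z%:~R) -[4]/(4%:~R) -intrM ltr_int.
have : 0 < B%:R :> R by rewrite ltr0n.
lra.
Qed.

(** Each use of [decode_step] on the doubled residual [w] halves the later errors, so they sum to at
    most 1. The starting bound [|z i| <= B] contributes [B / 2 ^ m], which is at most 1 for
    [m = B]. *)
Lemma approx_row_space (z : I -> int) : \sum_i z i ^+ 2 <= B%:Z ->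
  exists y : J -> R, forall i, `|(z i)%:~R - \sum_k y k * (-1) ^+ G k i| <= 2.
Proof.
have iter m : forall z : I -> int, \sum_i z i ^+ 2 <= B%:Z ->
    exists y : J -> R, forall i,
      `|(z i)%:~R - \sum_k y k * (-1) ^+ G k i| <= 1 + B%:R / 2 ^+ m.
  elim: m => [|m IH] {}z hz.
    exists (fun=> 0) => i; rewrite big1 => [|k _]; last by rewrite mul0r.
    rewrite subr0 expr0 divr1 -intr_norm -abszE.
    have : (`|z i|%N <= B)%N by exact: sum_sqr_norm_le.
    by rewrite -(ler_nat R) => h; rewrite (le_trans h) // lerDr.
  have [y [w [hw hy]]] := decode_step hz; have [y' hy'] := IH _ hw.
  exists (fun k => y k + y' k / 2) => i.
  have -> : (z i)%:~R - \sum_k (y k + y' k / 2) * (-1) ^+ G k i =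
     ((z i)%:~R - \sum_k y k * (-1) ^+ G k i - (w i)%:~R / 2) +
     ((w i)%:~R - \sum_k y' k * (-1) ^+ G k i) / 2.
    under eq_bigr do rewrite mulrDl mulrAC.
    by rewrite big_split /= -mulr_suml; field.
  apply: (le_trans (ler_normD _ _)); have := hy i; have := hy' i.
  rewrite [X in _ + X <= _]normrM [ `|2^-1|]ger0_norm // exprS invfM mulrCA.
  set p := B%:R / _; lra.
move=> hz; have [y hy] := iter B z hz; exists y => i; apply: (le_trans (hy i)).
have : B%:R / 2 ^+ B <= 1 :> R.
  rewrite ler_pdivrMr ?exprn_gt0 // mul1r -natrX ler_nat ltnW //; exact: ltn_expl.
lra.
Qed.

End Decoding.


(** * Finite uniform probability spaces realized on the unit interval *)

Lemma leb_measurable (R : realType) (A : set R) :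
  measurable (A : set (measurableTypeR R)) -> measurable (A : set (lebT R)).
Proof. exact: sub_caratheodory. Qed.

Lemma leb_itv (R : realType) (i : interval R) :
  leb ([set` i] : set (lebT R)) =
  (if (i.1 < i.2)%E then ((i.2 : \bar R) - i.1)%E else 0%R).
Proof. exact: lebesgue_measure_itv. Qed.

Lemma leb_set1 (R : realType) (a : R) : leb ([set a] : set (lebT R)) = 0%E.
Proof. exact: lebesgue_measure_set1. Qed.

Lemma leb_measurable_itv (R : realType) (i : interval R) :
  measurable ([set` i] : set (lebT R)).
Proof. by apply: leb_measurable; exact: measurable_itv. Qed.

Lemma measurable_unitI (R : realType) : measurable (@unitI R).
Proof. exact: leb_measurable_itv. Qed.

Lemma leb_unitI (R : realType) : leb (@unitI R) = 1%E.
Proof. by rewrite leb_itv /= lte_fin ltr01 -EFinB subr0. Qed.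

Lemma exists_uniform (R : realType) (J : finType) : (0 < #|J|)%N ->
  exists pt : lebT R -> J, forall j,
    measurable (unitI `&` [set t | pt t = j]) /\
    leb (unitI `&` [set t | pt t = j]) = (#|J|%:R^-1 : R)%:E.
Proof.
move=> J0; have [j0 _] : exists j0, j0 \in J by apply/card_gt0P.
have L0 : 0 < #|J|%:R :> R by rewrite ltr0n.
(* Equal intervals are sent to the successive elements of [J]. At [t = 1] the index is out of range
   and [nth] returns the default [j0]; the null set [E] accounts for this point. *)
pose pt (t : lebT R) := nth j0 (enum J) (Num.truncn (#|J|%:R * (t : R))).
exists pt => j; pose i := index j (enum J).
have iL : (i < #|J|)%N by rewrite cardE index_mem mem_enum.
pose I : set (lebT R) := `[i%:R / #|J|%:R : R, i.+1%:R / #|J|%:R[%classic.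
have mI : measurable I by exact: leb_measurable_itv.
have lI : leb I = (#|J|%:R^-1 : R)%:E.
  rewrite leb_itv /= lte_fin ltr_pM2r ?invr_gt0 // ltr_nat ltnSn -EFinB.
  by rewrite -mulrBl -natrB // subSnn mul1r.
pose E : set (lebT R) := if j == j0 then [set (1 : R)] else set0.
have mE : measurable E.
  by rewrite /E; case: ifP => _ //; apply: leb_measurable; exact: measurable_set1.
have lE : leb E = 0%E.
  by rewrite /E; case: ifP => _; [exact: leb_set1 | exact: measure0].
suff -> : unitI `&` [set t | pt t = j] = I `|` E.
  split; first exact: measurableU.
  by rewrite -lI; apply: measureU0.
have iE t : 0 <= t -> (Num.truncn (#|J|%:R * t) == i) = (t \in I).
  move=> t0; rewrite truncn_eq; last by rewrite mulr_ge0 // ltW.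
  by rewrite /I mem_setE in_itv /= ler_pdivrMr // ltr_pdivlMr // mulrC.
apply/seteqP; split=> t /=.
  rewrite /unitI /= in_itv /= => -[/andP[t0 t1] ptj].
  have [t1'|t1'] := ltP t 1.
    left; apply/set_mem; rewrite -iE //.
    rewrite /i -ptj /pt index_uniq ?enum_uniq // -cardE.
    by rewrite truncn_lt_nat ?mulr_ge0 ?(ltW L0) // gtr_pMr.
  right; have te : t = 1 by apply/le_anti; rewrite t1 t1'.
  rewrite /E -ptj /pt te mulr1 natrK nth_default ?eqxx // -cardE //.
move=> [It|].
  have t0 : 0 <= t.
    by move: It; rewrite /I /= in_itv /= => /andP[h _]; apply: le_trans h; rewrite divr_ge0.
  have := mem_set It; rewrite -iE // => /eqP ti; split.
    rewrite /unitI /= in_itv /= t0 /=.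
    move: It; rewrite /I /= in_itv /= => /andP[_ /ltW h]; apply: (le_trans h).
    by rewrite ler_pdivrMr // mul1r ler_nat.
  by rewrite /pt ti /i nth_index // mem_enum.
rewrite /E; case: eqP => [->|_ //] /= ->; split.
  by rewrite /unitI /= in_itv /= ler01 lexx.
by rewrite /pt mulr1 natrK nth_default // -cardE.
Qed.

Section Uniform.
Variables (R : realType) (J : finType) (pt : lebT R -> J).
Hypothesis pt_uniform : forall j,
    measurable (unitI `&` [set t | pt t = j]) /\
    leb (unitI `&` [set t | pt t = j]) = (#|J|%:R^-1 : R)%:E.

Lemma leb_uniform (S : {pred J}) :
  measurable (unitI `&` [set t | pt t \in S]) /\
  leb (unitI `&` [set t | pt t \in S]) = (#|S|%:R / #|J|%:R : R)%:E.
Proof.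
suff H s : uniq s -> measurable (unitI `&` [set t | pt t \in s]) /\
    leb (unitI `&` [set t | pt t \in s]) = ((size s)%:R / #|J|%:R : R)%:E.
  have := H (enum S) (enum_uniq _); rewrite -cardE.
  by under [in X in X -> _]eq_set do rewrite mem_enum.
elim: s => [_|j s IH /= /andP[js /IH[m1 m2]]].
  rewrite (_ : _ `&` _ = set0); last by apply/seteqP; split=> t //= -[].
  by rewrite measure0 mul0r.
have [p1 p2] := pt_uniform j.
have -> : unitI `&` [set t | pt t \in j :: s] =
   (unitI `&` [set t | pt t = j]) `|` (unitI `&` [set t | pt t \in s]).
  apply/seteqP; split=> t /=.
    by rewrite inE => -[It /orP[/eqP|]]; [left|right].
  by move=> [[It ->]|[It ts]]; rewrite inE ?eqxx ?ts ?orbT.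
split; first exact: measurableU.
rewrite [LHS]measureU //; last first.
  by apply/seteqP; split=> t //= -[[_ ->]]; rewrite (negPf js) => -[].
by rewrite [X in (X + _)%E]p2 [X in (_ + X)%E]m2 -EFinD -natr1; congr _%:E; ring.
Qed.

Lemma measurable_uniform_comp (F : J -> R) : measurable_fun unitI (F \o pt).
Proof.
move=> _ B _; rewrite (_ : _ @^-1` _ = [set t | pt t \in [pred j | F j \in B]]).
  exact: (leb_uniform _).1.
by apply/seteqP; split=> t /=; rewrite !inE.
Qed.

(** Disjointness of [S] and [T] makes the two terms the positive and negative parts of the
    integrand, so the definition of the integral applies directly. *)
Lemma integral_uniform_eq0 (S T : {pred J}) (c : R) : 0 <= c ->
  (forall j, j \in S -> j \notin T) -> #|S| = #|T| ->
  (\int[leb]_(t in unitI)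
     (c * (pt t \in S)%:R - c * (pt t \in T)%:R)%:E)%E = 0%E.
Proof.
move=> c0 ST eST.
have int_mem (U : {pred J}) : (\int[leb]_(t in unitI)
    (c * (pt t \in U)%:R)%:E = (c * (#|U|%:R / #|J|%:R))%:E)%E.
  have [mU lU] := leb_uniform U.
  transitivity (\int[leb]_(t in unitI)
      (c * \1_(unitI `&` [set t | pt t \in U]) t)%:E)%E.
    apply: eq_integral => t; rewrite inE => It; congr (c * _)%:E.
    rewrite indicE; congr (nat_of_bool _)%:R.
    rewrite in_setI (mem_set It) /=.
    by apply/idP/idP => h; [exact/mem_set | exact: (set_mem h)].
  have mI := @measurable_unitI R.
  rewrite (integralZl_indic mI (fun=> unitI `&` [set t | pt t \in U])) //;
    last by rewrite ltNge c0.
  rewrite integral_indic //.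
  by rewrite (setIidl (@subIsetl _ _ _)) [X in (_ * X)%E]lU.
rewrite integralE [X in (X - _)%E](_ : _ = (c * (#|S|%:R / #|J|%:R))%:E)%E.
  rewrite [X in (_ - X)%E](_ : _ = (c * (#|T|%:R / #|J|%:R))%:E)%E.
    by rewrite eST subee.
  rewrite -int_mem; apply: eq_integral => t _; rewrite funenegE -EFinN -EFin_max.
  congr _%:E; case: (boolP (pt t \in S)) => [/ST/negPf ->|_] /=.
    by rewrite !mulr0 subr0 mulr1 max_r // oppr_le0.
  by rewrite mulr0 sub0r opprK max_l // mulr_ge0.
rewrite -int_mem; apply: eq_integral => t _; rewrite funeposE -EFin_max.
congr _%:E; case: (boolP (pt t \in S)) => [/ST/negPf ->|_] /=.
  by rewrite mulr0 subr0 max_l // mulr_ge0.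
by rewrite mulr0 sub0r max_r // oppr_le0 mulr_ge0.
Qed.

End Uniform.


(** * Indicators and the fundamental function in a symmetric space *)

Section SymmetricSpace.
Variables (R : realType) (X : symmetric_space R).
Implicit Types A B : set (lebT R).

Lemma ss_bounded (y : lebT R -> R) (M : R) : 0 <= M -> measurable_fun unitI y ->
  {ae leb, forall t, unitI t -> `|y t| <= M} -> ss_mem X y /\ ss_norm X y <= M.
Proof.
move=> M0 my yM.
have [|h1 h2] := ss_ideal (ss_memZ M (ss_mem1 X)) my.
  apply: filterS yM => t h It; apply: (le_trans (h It)).
  by rewrite indicE mem_set // mulr1 ler_norm.
split=> //; apply: (le_trans h2).
by rewrite ss_normZ ?ss_norm1 ?mulr1 ?ger0_norm //; exact: ss_mem1.
Qed.

Lemma measurable_fun_unitI_indic A : measurable A ->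
  measurable_fun unitI (\1_A : lebT R -> R).
Proof. by move=> mA; exact: measurable_indic. Qed.

Lemma ss_mem_indic A : measurable A -> ss_mem X \1_A.
Proof.
move=> mA; apply: (ss_bounded ler01 (measurable_fun_unitI_indic mA) _).1.
by apply: aeW => t _; rewrite indicE ger0_norm // lern1 leq_b1.
Qed.

Lemma ss_norm_indic_mono A B : measurable A -> measurable B ->
  unitI `&` A `<=` B -> ss_norm X \1_A <= ss_norm X \1_B.
Proof.
move=> mA mB AB.
apply: (ss_ideal (ss_mem_indic mB) (measurable_fun_unitI_indic mA) _).2.
apply: aeW => t It; rewrite !indicE !ger0_norm // ler_nat.
by case: (boolP (t \in A)) => // /set_mem At; rewrite (mem_set (AB _ (conj It At))).
Qed.

(** The two indicators are equidistributed: a preimage is empty, everything, the set or its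
    complement, and the measure of the complement is determined since [unitI] has finite measure. *)
Lemma ss_norm_indic_eq A B : measurable A -> measurable B ->
  leb (unitI `&` A) = leb (unitI `&` B) -> ss_norm X \1_A = ss_norm X \1_B.
Proof.
move=> mA mB eAB; have mI := @measurable_unitI R.
have normi (C : set (lebT R)) : (fun t => `|\1_C t|) = \1_C :> (lebT R -> R).
  by apply/funext => t; rewrite ger0_norm.
apply/esym/(ss_symmetric (ss_mem_indic mA) (measurable_fun_unitI_indic mB) _).2.
move=> S mS; rewrite !normi !preimage_indic; case: ifP => _; case: ifP => _ //.
have lC (C : set (lebT R)) : measurable C -> leb (unitI `&` ~` C) = (1 - leb (unitI `&` C))%E.
  move=> mC; have mIC : measurable (unitI `&` C) by exact: measurableI.
  have fC : leb (unitI `&` C) \is a fin_num.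
    rewrite ge0_fin_numE //; apply: (@le_lt_trans _ _ (leb (@unitI R))).
      by apply: le_measure; rewrite ?inE //; exact: subIsetl.
    by rewrite leb_unitI ltry.
  by rewrite -leb_unitI (measureDI _ mI mC) addeK // setDE.
by rewrite !lC // eAB.
Qed.

Lemma leb_unitI_itv (t : R) : 0 <= t <= 1 ->
  leb (unitI `&` (`]0, t]%classic : set (lebT R))) = t%:E.
Proof.
move=> /andP[t0 t1]; rewrite setIidr; last first.
  move=> x /=; rewrite /unitI /= !in_itv /= => /andP[/ltW -> h].
  exact: le_trans t1.
rewrite leb_itv /= lte_fin; case: ltP => [_|h]; first by rewrite -EFinB subr0.
by congr _%:E; apply: le_anti; rewrite t0 h.
Qed.

Lemma ss_norm_indicE A (t : R) : measurable A -> 0 <= t <= 1 ->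
  leb (unitI `&` A) = t%:E -> ss_norm X \1_A = fundamental_function X t.
Proof.
move=> mA t01 lA; apply: ss_norm_indic_eq => //; first exact: leb_measurable_itv.
by rewrite lA leb_unitI_itv.
Qed.

Lemma fundamental_function_mono (s t : R) : s <= t ->
  fundamental_function X s <= fundamental_function X t.
Proof.
move=> st; apply: ss_norm_indic_mono; try exact: leb_measurable_itv.
by move=> x [_] /=; rewrite !in_itv /= => /andP[-> h]; exact: le_trans st.
Qed.

Lemma fundamental_function_ge0 (t : R) : 0 <= fundamental_function X t.
Proof. by apply: ss_norm_ge0; apply: ss_mem_indic; exact: leb_measurable_itv. Qed.

Lemma fundamental_function_gt0 (t : R) : 0 < t <= 1 -> 0 < fundamental_function X t.
Proof.
move=> /andP[t0 t1]; rewrite lt_neqAle fundamental_function_ge0 andbT eq_sym.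
apply/eqP => /(ss_norm_eq0 (ss_mem_indic (leb_measurable_itv _))).1.
move=> [N [mN N0 hN]].
pose A : set (lebT R) := `]0, t]%classic.
have mA : measurable A by exact: leb_measurable_itv.
have : (leb (unitI `&` A) <= leb N)%E.
  apply: le_measure; rewrite ?inE //.
    by apply: measurableI => //; exact: measurable_unitI.
  move=> x [Ix xt]; apply: hN => /= /(_ Ix) /eqP.
  by rewrite indicE mem_set // oner_eq0.
by rewrite leb_unitI_itv ?(ltW t0) // N0 lee_fin leNgt t0.
Qed.

Lemma leb_unitI_fin A : measurable A ->
  exists2 t : R, leb (unitI `&` A) = t%:E & 0 <= t <= 1.
Proof.
move=> mA; have mI := @measurable_unitI R.
have h0 : (0 <= leb (unitI `&` A))%E by exact: measure_ge0.
have h1 : (leb (unitI `&` A) <= 1)%E.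
  rewrite -leb_unitI; apply: le_measure; rewrite ?inE //; exact: measurableI.
by move: h0 h1; case: (leb _) => // r; rewrite !lee_fin => h0 h1; exists r; rewrite ?h0.
Qed.

Lemma ss_norm_indic_le A (t : R) : measurable A ->
  (leb (unitI `&` A) <= t%:E)%E -> ss_norm X \1_A <= fundamental_function X t.
Proof.
move=> mA; have [s ls s01] := leb_unitI_fin mA; rewrite ls lee_fin => st.
by rewrite (ss_norm_indicE mA s01 ls); exact: fundamental_function_mono.
Qed.

Lemma Linfty_sub : @Linfty R `<=` ss_mem X.
Proof.
move=> x /andP[]; rewrite !inE /= => mx.
rewrite /finite_norm unlock /= => hx.
have mI := @measurable_unitI R.
have ltI : (0 < leb [set: lebT R])%E.
  apply: (@lt_le_trans _ _ (leb (@unitI R))); first by rewrite leb_unitI.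
  by apply: le_measure; rewrite ?inE.
move: hx; rewrite ltI => hx.
have mxI : measurable_fun unitI x by exact/(measurable_restrictT _ mI).
pose M := Num.max 0 (fine (ess_sup leb (abse \o (EFin \o (x \_ unitI))))).
apply: (ss_bounded (M := M) _ mxI _).1; first by rewrite le_max lexx.
apply: filterS (ess_sup_ge leb (abse \o (EFin \o (x \_ unitI)))) => t + It /=.
rewrite /= patchE mem_set // => h; rewrite -lee_fin; apply: (le_trans h).
rewrite /M; move: hx h; case: (ess_sup _ _) => [r| |] //= _ h.
  by rewrite lee_fin le_max lexx orbT.
Qed.

(** Chebyshev's inequality in [X]: if the set [A] where [|x| > n] had positive measure, then
    [n * e <= ss_norm X x], contrary to [n = ss_norm X x / e + 1]. *)
Lemma sub_Linfty (e : R) : 0 < e ->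
  (forall t, 0 < t <= 1 -> e <= fundamental_function X t) ->
  ss_mem X `<=` @Linfty R.
Proof.
move=> e0 he x Xx; have mx := ss_measurable Xx; have mI := @measurable_unitI R.
have nx0 := ss_norm_ge0 Xx.
pose n : R := ss_norm X x / e + 1.
have n0 : 0 < n by rewrite ltr_wpDl // divr_ge0 // ltW.
pose A : set (lebT R) := unitI `&` (fun t => `|x t|) @^-1` `]n, +oo[%classic.
have mnx : measurable_fun unitI (fun t => `|x t|) by exact: measurableT_comp.
have mA : measurable A by apply: mnx => //; exact: measurable_itv.
have hA : n * ss_norm X \1_A <= ss_norm X x.
  have -> : n * ss_norm X \1_A = ss_norm X (fun t => n * \1_A t).
    by rewrite ss_normZ ?gtr0_norm //; exact: ss_mem_indic.
  apply: (ss_ideal Xx _ _).2.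
    by apply: measurable_funM => //; exact: measurable_indic.
  apply: aeW => t It; rewrite indicE.
  case: (boolP (t \in A)) => [/set_mem [_ /=]|_]; last by rewrite mulr0 normr0.
  by rewrite in_itv /= andbT mulr1 (gtr0_norm n0) => /ltW.
have lA : leb A = 0%E.
  have [s ls /andP[s0 s1]] := leb_unitI_fin mA.
  have AI : unitI `&` A = A by apply: setIidr; exact: subIsetl.
  rewrite -AI ls; congr _%:E; apply: contrapT => /eqP sn0.
  have s01 : 0 < s <= 1 by rewrite lt_neqAle eq_sym sn0 s0.
  have := he s s01; have s01' : 0 <= s <= 1 by rewrite s0.
  rewrite -(ss_norm_indicE mA s01' ls) => h.
  have := le_trans (ler_wpM2l (ltW n0) h) hA.
  by rewrite /n mulrDl mul1r divfK ?gt_eqF // gerDl leNgt e0.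
have xn : {ae leb, forall t, unitI t -> `|x t| <= n}.
  exists A; split=> // t /= hn; apply: contrapT => nA; apply: hn => It.
  by rewrite leNgt; apply/negP => nx; apply: nA; split=> //=; rewrite in_itv /= nx.
apply/andP; split; rewrite inE /=; first exact/(measurable_restrictT _ mI).
rewrite /finite_norm unlock /=; case: ifP => // _.
apply: (@le_lt_trans _ _ n%:E); last exact: ltry.
apply/ess_supP; apply: filterS xn => t h /=; rewrite lee_fin patchE.
by case: ifPn => [/set_mem /h //|_]; rewrite normr0 ltW.
Qed.

(** A positive lower bound for the fundamental function on []0, 1]] would force [X = L_oo] by
    [sub_Linfty]. *)
Lemma fundamental_function_small : ss_mem X <> @Linfty R ->
  forall e : R, 0 < e -> exists2 d, 0 < d <= 1 & fundamental_function X d < e.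
Proof.
move=> neq e e0; apply: contrapT => hn; apply: neq; apply/seteqP; split.
  apply: (sub_Linfty e0) => t t01; rewrite leNgt; apply/negP => h.
  by apply: hn; exists t.
exact: Linfty_sub.
Qed.

(** With [q] the integer part of [1 / t], monotonicity and [t <= 1 / q] pass from [t] to [1 / q];
    the factor 2 comes from [1 / t < q + 1 <= 2 q]. *)
Lemma exists_nat_fundamental_large :
  limf_esup (fun t : R => (fundamental_function X t * t `^ (- 2^-1))%:E) 0^'+ = +oo%E ->
  forall (T : R) (Q : nat), 0 <= T -> exists q : nat, [/\ (Q <= q)%N, (0 < q)%N &
    T < fundamental_function X q%:R^-1 * Num.sqrt (2 * q%:R)].
Proof.
rewrite limf_esupE => hsup T Q T0; pose r : R := Q.+1%:R^-1.
have r0 : 0 < r by rewrite invr_gt0.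
have r1 : r <= 1 by rewrite invf_le1 // ler1n.
have [t [t0 tr ht]] : exists t, [/\ 0 < t, t < r &
    T < fundamental_function X t * t `^ (- 2^-1)].
  apply: contrapT => hn.
  have : (+oo <= T%:E :> \bar R)%E.
    rewrite -hsup; apply: (@le_trans _ _ (ereal_sup
      [set (fundamental_function X t * t `^ (- 2^-1))%:E | t in `]0, r[%classic])).
      apply: ereal_inf_lbound => /=; exists `]0, r[%classic => //.
      apply: filterS (filterI (nbhs_right_gt 0) (nbhs_right_lt r0)) => y [y0 yr].
      by rewrite /= in_itv /= y0.
    apply: ge_ereal_sup => _ [t /= + <-]; rewrite in_itv /= => /andP[t0 tr].
    by rewrite lee_fin leNgt; apply/negP => h; apply: hn; exists t.
  by rewrite leye_eq.
pose q := Num.truncn t^-1.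
have ti : 0 < t^-1 by rewrite invr_gt0.
have Qt : Q.+1%:R <= t^-1 by rewrite -[leLHS]invrK lef_pV2 ?posrE // ltW.
have Qq : (Q.+1 <= q)%N by rewrite truncn_ge_nat // ltW.
have q0 : (0 < q)%N by exact: leq_trans Qq.
have q0' : 0 < q%:R :> R by rewrite ltr0n.
have qt : q%:R <= t^-1 by rewrite truncn_le ltW.
have tq : t^-1 < q.+1%:R by exact: truncnS_gt.
exists q; split => //; first exact: ltnW.
apply: (lt_le_trans ht); rewrite powRN powR12_sqrt ?(ltW t0) // -sqrtrV ?(ltW t0) //.
apply: ler_pM; rewrite ?fundamental_function_ge0 ?sqrtr_ge0 //.
  by apply: fundamental_function_mono; rewrite -[leLHS]invrK lef_pV2 ?posrE.
rewrite ler_wsqrtr //; apply: (le_trans (ltW tq)).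
by rewrite -natr1 mulr_natl mulr2n lerD2l ler1n.
Qed.

End SymmetricSpace.


(** * The decoder with its parameters, and an integer square root *)

Lemma exists_approx_row_space (R : realType) (gamma : R) : 0 < gamma ->
  exists2 p : nat, (0 < p)%N & \forall B \near \oo,
  exists G : 'I_(Num.truncn (gamma * (p * B)%:R)) -> 'I_(p * B) -> R,
  forall z : 'I_(p * B) -> int, \sum_i z i ^+ 2 <= B%:Z ->
  exists y, forall i, `|(z i)%:~R - \sum_k y k * G k i| <= 2.
Proof.
move=> g0; have [p p0 hp] := exists_almost_isometry_params g0.
exists p => //; near=> B.
have B1 : (1 <= B)%N by near: B; exists 1%N.
(* This guarantees that the matrix has at least one row, as the division by the number of rows
   requires. *)
have gB : gamma^-1 <= B%:R by near: B; exact: nbhs_infty_ger.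
have n0 : (0 < Num.truncn (gamma * (p * B)%:R))%N.
  rewrite truncn_gt0 natrM mulrCA; have h : 1 <= gamma * B%:R.
    by rewrite -ler_pdivrMl // mulr1.
  by apply: (le_trans h); rewrite ler_peMl ?ler1n // (le_trans _ h).
have hB : forall I : finType, #|I| = (p * B)%N ->
  exists G : {ffun 'I_(Num.truncn (gamma * #|I|%:R)) -> {ffun I -> bool}},
  forall z : I -> int, \sum_i z i ^+ 2 <= (4 * B)%:Z ->
    `|sq_image R G z - (Num.truncn (gamma * #|I|%:R))%:R * sqnorm R z| <=
      (Num.truncn (gamma * #|I|%:R))%:R * B%:R / 8 by near: B.
have := hB 'I_(p * B)%N; rewrite card_ord => /(_ erefl)[G hG].
exists (fun k i => (-1) ^+ G k i) => z hz.
by apply: (approx_row_space _ B1 _ hz); rewrite card_ord.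
Unshelve. all: by end_near. Qed.

Lemma exists_nat_sqrt (d q : nat) : (0 < d)%N ->
  exists m, (d * m ^ 2 <= q < d * m.+1 ^ 2)%N.
Proof.
move=> d0; elim: q => [|q [m /andP[h1 h2]]]; first by exists 0%N; lia.
have [h|h] := ltnP q.+1 (d * m.+1 ^ 2); first by exists m; lia.
by exists m.+1; apply/andP; split=> //; nia.
Qed.

(** * Words with independent uniform letters *)

Lemma card_familyE (I D : finType) (F : I -> {pred D}) :
  #|family F| = (\prod_i #|F i|)%N.
Proof. by rewrite card_family foldrE big_map big_enum. Qed.

Lemma card_coord (I D : finType) (k : I) (S : {pred D}) :
  (#|[pred w : {ffun I -> D} | w k \in S]| * #|D| = #|S| * #|{ffun I -> D}|)%N.
Proof.
have -> : #|[pred w : {ffun I -> D} | w k \in S]| =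
    #|family (fun i => [pred d | (i == k) ==> (d \in S)])|.
  apply: eq_card => w; rewrite !inE; apply/idP/familyP => [h i|/(_ k)].
    by rewrite inE; apply/implyP => /eqP ->.
  by rewrite inE eqxx.
rewrite card_familyE (bigD1 k) //= card_ffun.
rewrite (eq_bigr (fun=> #|D|)); last first.
  by move=> i /negPf ik; apply: eq_card => d; rewrite !inE ik.
have -> : #|[pred d | (k == k) ==> (d \in S)]| = #|S|.
  by apply: eq_card => d; rewrite !inE eqxx.
rewrite prod_nat_const.
rewrite -mulnA -expnSr; congr (_ * _ ^ _)%N.
by rewrite -[RHS](cardC (pred1 k)) card1 add1n; congr _.+1; exact: eq_card.
Qed.

Section Coordinates.
Variables (R : realType) (N : nat) (D : finType).
Variable pt : lebT R -> {ffun 'I_N -> D}.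
Hypothesis D0 : (0 < #|D|)%N.
Hypothesis pt_uniform : forall w,
    measurable (unitI `&` [set t | pt t = w]) /\
    leb (unitI `&` [set t | pt t = w]) = (#|{ffun 'I_N -> D}|%:R^-1 : R)%:E.

Lemma leb_coord (k : 'I_N) (S : {pred D}) :
  leb (unitI `&` [set t | pt t k \in S]) = (#|S|%:R / #|D|%:R : R)%:E.
Proof.
have := (leb_uniform pt_uniform [pred w : {ffun 'I_N -> D} | w k \in S]).2.
rewrite (_ : [set t | pt t \in _] = [set t | pt t k \in S]) => [->|]; last first.
  by apply/seteqP; split=> t /=; rewrite inE.
have d0 : #|D|%:R != 0 :> R by rewrite pnatr_eq0 -lt0n.
have j0 : #|{ffun 'I_N -> D}|%:R != 0 :> R.
  by rewrite pnatr_eq0 card_ffun expn_eq0 negb_and -lt0n D0.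
by congr _%:E; apply/eqP; rewrite eqr_div // -!natrM card_coord.
Qed.

Lemma independent_coord (h : D -> R) : independent (fun k t => h (pt t k)).
Proof.
move=> B _; pose S k := [pred d | h d \in B k].
have -> : [set t | forall k, B k (h (pt t k))] = [set t | pt t \in family S].
  apply/seteqP; split=> t /=.
    by move=> H; apply/familyP => k; rewrite inE; exact: H.
  by move=> /familyP H k; have := H k; rewrite inE.
rewrite [LHS](leb_uniform pt_uniform _).2.
under [RHS]eq_bigr => k _.
  rewrite (_ : (fun t => _) @^-1` _ = [set t | pt t k \in S k]); last first.
    by apply/seteqP; split=> t /=; rewrite !inE.
  rewrite leb_coord; over.
rewrite prodEFin; congr _%:E.
by rewrite card_familyE natr_prod card_ffun natrX card_ord prodf_div prodr_const card_ord.
Qed.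

End Coordinates.

(** Markov's inequality for [2 ^ r], where [r] is the number of letters in [S]: its sum over all
    words is a product of [#|I|] equal factors [#|D| + #|S|]. *)
Lemma card_many_large (I D : finType) (S : {pred D}) (m : nat) :
  (#|[pred w : {ffun I -> D} | m <= #|[pred i | w i \in S]|]| * 2 ^ m <=
   (#|D| + #|S|) ^ #|I|)%N.
Proof.
have -> : ((#|D| + #|S|) ^ #|I| =
    \sum_(w : {ffun I -> D}) 2 ^ #|[pred i | w i \in S]|)%N.
  transitivity (\sum_(w : {ffun I -> D}) \prod_i 2 ^ (w i \in S))%N.
    rewrite -(bigA_distr_bigA (fun=> fun d => 2 ^ (d \in S))%N) /= prod_nat_const.
    congr (_ ^ _)%N; rewrite -sum1_card -[#|S|]sum1_card [X in (_ + X)%N]big_mkcond.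
    by rewrite -big_split /=; apply: eq_bigr => d _; case: (d \in S).
  apply: eq_bigr => w _; rewrite -expn_sum; congr (_ ^ _)%N.
  by rewrite -sum1_card [RHS]big_mkcond; apply: eq_bigr => i _; rewrite inE; case: ifP.
rewrite -sum1_card big_distrl /= big_mkcond /=; apply: leq_sum => w _.
by case: ifP => //; rewrite inE mul1n => h; rewrite leq_exp2l.
Qed.


(** * Upper bounds for Kolmogorov widths *)

Lemma ss_mem_sum (R : realType) (X : symmetric_space R) (I : finType)
    (a : I -> R) (b : I -> lebT R -> R) : (forall i, ss_mem X (b i)) ->
  ss_mem X (fun t => \sum_i a i * b i t).
Proof.
move=> hb; elim: (index_enum I) => [|i r IH].
  by under eq_fun do rewrite big_nil; exact: ss_mem0.
by under eq_fun do rewrite big_cons; apply: ss_memD => //; exact: ss_memZ.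
Qed.

Lemma kolmogorov_width_le (R : realType) (X : symmetric_space R) (N n : nat)
    (f : 'I_N -> lebT R -> R) (b : 'I_n -> lebT R -> R)
    (a : 'I_N -> 'I_n -> R) (e : R) : (forall i, ss_mem X (b i)) ->
  (forall k, ss_norm X (fun t => f k t - \sum_i a k i * b i t) <= e) ->
  (kolmogorov_width X (range f) n <= e%:E)%E.
Proof.
move=> hb he.
pose V : set (lebT R -> R) := [set v | exists c, v = fun t => \sum_i c i * b i t].
apply: ge_ereal_inf; exists (ereal_sup
   [set ereal_inf [set (ss_norm X (fun t => x t - v t))%:E | v in V]
       | x in range f]).
  exists V => //; split.
    split.
    - by move=> _ [c ->]; exact: ss_mem_sum.
    - exists (fun=> 0); apply/funext => t.
      by rewrite big1 // => i _; rewrite mul0r.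
    - move=> _ _ [c ->] [d ->]; exists (fun i => c i + d i); apply/funext => t.
      by rewrite -big_split /=; apply: eq_bigr => i _; rewrite mulrDl.
    - move=> x _ [c ->]; exists (fun i => x * c i); apply/funext => t.
      by rewrite mulr_sumr; apply: eq_bigr => i _; rewrite mulrA.
  exists b.
    move=> i; exists (fun j => (i == j)%:R); apply/funext => t.
    rewrite (bigD1 i) //= eqxx mul1r big1 ?addr0 // => j /negPf.
    by rewrite eq_sym => ->; rewrite mul0r.
  by move=> _ [c ->]; exists c; apply: aeW.
apply: ge_ereal_sup => _ [_ [k _ <-] <-].
apply: ge_ereal_inf; exists (ss_norm X (fun t => f k t - \sum_i a k i * b i t))%:E.
  by exists (fun t => \sum_i a k i * b i t) => //; exists (a k).
by rewrite lee_fin.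
Qed.

(** * Independent three-valued functions and their approximation *)

Section Digits.
Variable q : nat.
Hypothesis q0 : (0 < q)%N.

(** A uniform letter of ['I_q * bool] encodes the three-valued variable: it is nonzero when its
    first component is 0, with probability [1 / q], and the boolean then gives the sign. *)
Definition pos_digit : {pred 'I_q * bool} := [pred d : 'I_q * bool | (d.1 == 0%N :> nat) && ~~ d.2].
Definition neg_digit : {pred 'I_q * bool} := [pred d : 'I_q * bool | (d.1 == 0%N :> nat) && d.2].
Definition nz_digit : {pred 'I_q * bool} := [pred d : 'I_q * bool | d.1 == 0%N :> nat].

Definition digit_sign (d : 'I_q * bool) : int := (d \in pos_digit)%:Z - (d \in neg_digit)%:Z.

Lemma digit_sign_sqr d : digit_sign d ^+ 2 = (d \in nz_digit)%:Z.
Proof. by rewrite /digit_sign !inE; case: d => i [] /=; case: (_ == _). Qed.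

Lemma digit_signE (R : realType) d :
  (digit_sign d)%:~R = (d \in pos_digit)%:R - (d \in neg_digit)%:R :> R.
Proof. by rewrite intrB. Qed.

Lemma pos_digit_neg d : d \in pos_digit -> d \notin neg_digit.
Proof. by rewrite !inE => /andP[_ /negPf ->]; rewrite andbF. Qed.

Lemma card_pos_digit : #|pos_digit| = 1%N.
Proof.
rewrite (eq_card (B := pred1 (Ordinal q0, false))) ?card1 // => -[i b].
by rewrite !inE xpair_eqE eqbF_neg.
Qed.

Lemma card_neg_digit : #|neg_digit| = 1%N.
Proof.
rewrite (eq_card (B := pred1 (Ordinal q0, true))) ?card1 // => -[i b].
by rewrite !inE xpair_eqE eqb_id.
Qed.

Lemma card_nz_digit : #|nz_digit| = 2%N.
Proof.
rewrite (eq_card (B := pred2 (Ordinal q0, true) (Ordinal q0, false))) ?card2 //.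
by move=> [i b]; rewrite !inE !xpair_eqE -andb_orr; case: b; rewrite andbT.
Qed.

End Digits.

(** [(1 + 1 / q) ^ q <= e], and [e <= 4] follows from [1 / 2 <= expR (- 2^-1)]. *)
Lemma pow_succ_le (R : realType) (q M : nat) : (0 < q)%N ->
  (1 + q%:R^-1) ^+ (q * M) <= 4 ^+ M :> R.
Proof.
move=> q0; rewrite exprM; apply: lerXn2r; rewrite ?nnegrE ?exprn_ge0 ?addr_ge0 //.
apply: (@le_trans _ _ (expR 1)).
  apply: (@le_trans _ _ (expR (q%:R^-1 * q%:R))).
    rewrite expRM_natr; apply: lerXn2r; rewrite ?nnegrE ?addr_ge0 ?expR_ge0 //.
    exact: expR_ge1Dx.
  by rewrite mulVf // pnatr_eq0 -lt0n.
have h := expR_ge1Dx (- 2^-1 : R); rewrite expRN in h.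
have e2 : expR (2^-1) <= 2 :> R.
  by rewrite -[leRHS]invrK -[leLHS]invrK lef_pV2 ?posrE ?invr_gt0 ?expR_gt0 //; lra.
have -> : expR 1 = expR (2^-1) * expR (2^-1) :> R.
  by rewrite -expRD; congr expR; field.
have := expR_ge0 (2^-1 : R); nra.
Qed.

(** [M = N / q] is the mean number of nonzero digits in a word. With fewer than [4 * M] of them, [m]
    times the word has square norm at most [B], so the word itself is decoded within [2 / m]; this
    gives [2 * c / m%:R]. The other term bounds the contribution of the remaining words. *)
Lemma exists_block_family (R : realType) (X : symmetric_space R)
    (q M N n m B : nat) (G : 'I_n -> 'I_N -> R)
    (c := (fundamental_function X q%:R^-1)^-1) :
  (0 < q)%N -> (0 < m)%N -> N = (q * M)%N -> (m ^ 2 * (4 * M) <= B)%N ->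
  (forall z : 'I_N -> int, \sum_i z i ^+ 2 <= B%:Z ->
    exists y, forall i, `|(z i)%:~R - \sum_k y k * G k i| <= 2) ->
  exists f : 'I_N -> lebT R -> R,
  [/\ forall k, ss_mem X (f k), independent f,
      forall k, (\int[leb]_(t in unitI) (f k t)%:E)%E = 0%E,
      forall k, 1 <= ss_norm X (f k) &
      (kolmogorov_width X (range f) n <=
       (2 * c / m%:R + c * fundamental_function X (4 ^- M))%:E)%E].
Proof.
move=> q0 m0 NE mB hG.
have qR : 0 < q%:R :> R by rewrite ltr0n.
have mR : 0 < m%:R :> R by rewrite ltr0n.
have q01 : 0 < (q%:R^-1 : R) <= 1 by rewrite invr_gt0 qR invf_le1 // ler1n.
have c0 : 0 < c by rewrite invr_gt0 fundamental_function_gt0.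
have mI := @measurable_unitI R.
pose D := ('I_q * bool)%type.
have cD : #|{: D}| = (q * 2)%N by rewrite card_prod card_ord card_bool.
have D0 : (0 < #|{: D}|)%N by rewrite cD muln_gt0 q0.
have J0 : (0 < #|{ffun 'I_N -> D}|)%N by rewrite card_ffun expn_gt0 D0.
have [pt hpt] := exists_uniform R J0.
pose f (k : 'I_N) (t : lebT R) : R := c * (digit_sign (pt t k))%:~R.
have lep (F : {ffun 'I_N -> D} -> R) (C : R) : 0 <= C ->
    (forall w, `|F w| <= C) -> ss_mem X (F \o pt).
  move=> C0 hF; have mF := measurable_uniform_comp hpt F.
  by have [|//] := ss_bounded X C0 mF; apply: aeW => t _ /=.
have sgn1 (d : D) : `|(digit_sign d)%:~R| <= 1 :> R.
  rewrite digit_signE; case: (d \in _); case: (d \in _);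
  by rewrite ?subrr ?subr0 ?sub0r ?normrN ?normr1 ?normr0.
have fX k : ss_mem X (f k).
  apply: (lep (fun w => c * (digit_sign (w k))%:~R) c (ltW c0)) => w.
  by rewrite normrM (gtr0_norm c0) ler_piMr // ltW.
exists f; split=> //.
- exact: (independent_coord D0 hpt (fun d => c * (digit_sign d)%:~R)).
- move=> k; rewrite /f; under eq_integral do rewrite digit_signE mulrBr.
  pose S (A : {pred D}) := [pred w : {ffun 'I_N -> D} | w k \in A].
  have := integral_uniform_eq0 hpt (S := S (@pos_digit q)) (T := S (@neg_digit q)) (ltW c0).
  rewrite /S /=; under eq_integral do rewrite !inE.
  apply => [w|]; first by rewrite !inE; exact: pos_digit_neg.
  apply/eqP; rewrite -(eqn_pmul2r D0).
  by rewrite !(card_coord k) card_pos_digit // card_neg_digit.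
(* On [A], of measure [1 / q], [f k] has absolute value [c], and [c] is chosen so that [c] times the
   indicator of [A] has norm 1. *)
- move=> k; pose A : set (lebT R) := unitI `&` [set t | pt t k \in @nz_digit q].
  have mA : measurable A.
    have := (leb_uniform hpt [pred w : {ffun 'I_N -> D} | w k \in @nz_digit q]).1.
    by congr measurable; apply/seteqP; split=> t /=; rewrite !inE.
  have lA : leb (unitI `&` A) = (q%:R^-1)%:E.
    rewrite /A setIA setIid (leb_coord D0 hpt) card_nz_digit // cD natrM.
    by congr _%:E; field; rewrite gt_eqF.
  have q01' : 0 <= (q%:R^-1 : R) <= 1 by case/andP: q01 => /ltW -> ->.
  have := ss_norm_indicE X mA q01' lA => nA.
  have -> : 1 = ss_norm X (fun t => c * \1_A t).
    rewrite ss_normZ ?(gtr0_norm c0) ?nA ?mulVf ?gt_eqF ?fundamental_function_gt0 //.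
    exact: ss_mem_indic.
  apply: (ss_ideal (fX k) _ _).2.
    by apply: measurable_funM => //; exact: measurable_fun_unitI_indic.
  apply: aeW => t It; rewrite /f !normrM ler_wpM2l //.
  rewrite indicE; case: (boolP (t \in A)) => [/set_mem [_ /= h]|_].
    have := digit_sign_sqr (pt t k); rewrite h normr1 => /(congr1 (fun x : int => x%:~R : R)).
    rewrite rmorphXn /= -[_ ^+ 2]real_normK ?num_real //.
    have := normr_ge0 ((digit_sign (pt t k))%:~R : R); set x := `|_|.
    by rewrite expr2 mulr1z; nra.
  by rewrite normr0.
pose nnz (w : {ffun 'I_N -> D}) := #|[pred i | w i \in @nz_digit q]|.
pose bad := [pred w : {ffun 'I_N -> D} | (4 * M <= nnz w)%N].
have good w : exists y : 'I_n -> R, ~~ bad w -> forall i,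
    `|m%:R * (digit_sign (w i))%:~R - \sum_k y k * G k i| <= 2.
  case: (boolP (bad w)) => [_|hw]; first by exists (fun=> 0).
  have [|y hy] := hG (fun i => m%:Z * digit_sign (w i)).
    under eq_bigr do rewrite exprMn digit_sign_sqr.
    rewrite -mulr_sumr (_ : \sum_i _ = (nnz w)%:Z); last first.
      rewrite /nnz -sum1_card -[RHS]natz natr_sum [RHS]big_mkcond.
      apply: eq_bigr => i _; rewrite -[i \in _]/(w i \in @nz_digit q).
      by case: (w i \in _).
    have := hw; rewrite /bad /= -ltnNge => hw'.
    rewrite -[m%:Z ^+ 2]/((m ^ 2)%N%:Z) -PoszM lez_nat.
    by apply: leq_trans mB; rewrite leq_mul2l (ltnW hw') orbT.
  by exists y => _ i; have := hy i; rewrite intrM.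
have [y hy] := choice good.
(* On good words the decoder applies to the rescaled word; bad words are dropped
   and only cost the norm of a set of measure at most 4^-M. *)
pose b (i : 'I_n) (t : lebT R) : R := if bad (pt t) then 0 else y (pt t) i.
pose Bad : set (lebT R) := unitI `&` [set t | pt t \in bad].
have [mBad lBad] := leb_uniform hpt bad.
(* The decoded coefficients, as functions of [t], span the approximating space. The fixed matrix [G]
   supplies the coefficients for each [f k], and the factor [c / m] undoes the scaling by [m]. *)
apply: (kolmogorov_width_le (b := b) (a := fun k i => c / m%:R * G i k)).
  move=> i; apply: (lep (fun w => if bad w then 0 else y w i)
    (\sum_w `|y w i|)); first by apply: sumr_ge0.
  move=> w; rewrite (bigD1 w) //=; case: ifP => _; rewrite ?normr0.
    by rewrite addr_ge0 // sumr_ge0.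
  by rewrite lerDl sumr_ge0.
move=> k.
have mem2 : ss_mem X (fun t => c * \1_Bad t) by apply: ss_memZ; exact: ss_mem_indic.
have mem1 : ss_mem X (fun t => 2 * c / m%:R * \1_unitI t).
  by apply: ss_memZ; exact: ss_mem1.
have k0 : 0 <= 2 * c / m%:R by rewrite divr_ge0 ?mulr_ge0 // ltW.
have bnd : ss_norm X (fun t => f k t - \sum_i c / m%:R * G i k * b i t) <=
   ss_norm X (fun t => 2 * c / m%:R * \1_unitI t + c * \1_Bad t).
  apply: (ss_ideal (ss_memD mem1 mem2) _ _).2.
    exact: (measurable_uniform_comp hpt (fun w => c * (digit_sign (w k))%:~R -
      \sum_i c / m%:R * G i k * (if bad w then 0 else y w i))).
  apply: aeW => t It; rewrite !indicE mem_set // mulr1 [leRHS]ger0_norm; last first.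
    by rewrite addr_ge0 // mulr_ge0 // ltW.
  rewrite /b /f; case: (boolP (bad (pt t))) => ht.
    rewrite big1 => [|i _]; last by rewrite mulr0.
    rewrite subr0 (mem_set (_ : Bad t)) // mulr1 normrM (gtr0_norm c0).
    by apply: (@le_trans _ _ c); [rewrite ler_piMr // ltW | rewrite lerDr].
  rewrite (_ : _ - _ = c / m%:R * (m%:R * (digit_sign (pt t k))%:~R
     - \sum_i y (pt t) i * G i k)); last first.
    rewrite mulrBr mulr_sumr mulrA divfK ?gt_eqF //; congr (_ - _).
    by apply: eq_bigr => i _; rewrite mulrAC mulrA.
  rewrite normrM ger0_norm; last by rewrite divr_ge0 // ltW.
  rewrite -[2 * c / _]mulrA mulrC.
  apply: (@le_trans _ _ (2 * (c / m%:R))); last by rewrite lerDl mulr_ge0 // ltW.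
  by rewrite ler_wpM2r ?hy // divr_ge0 // ltW.
apply: (le_trans bnd); apply: (le_trans (ss_normD mem1 mem2)).
rewrite !ss_normZ ?ss_norm1 ?mulr1 //; [|exact: ss_mem_indic|exact: ss_mem1].
rewrite (ger0_norm k0) (gtr0_norm c0) lerD2l ler_wpM2l ?(ltW c0) //.
apply: ss_norm_indic_le => //; rewrite /Bad setIA setIid.
rewrite [leLHS]lBad lee_fin card_ffun card_ord cD natrX ler_pdivrMr ?exprn_gt0 ?ltr0n ?muln_gt0 ?q0 //.
(* The measure of the bad words is at most [((2 q + 2) / (2 q)) ^ N / 2 ^ (4 M)], which is at most
   [4 ^ M / 16 ^ M]. *)
have := card_many_large 'I_N (@nz_digit q) (4 * M).
rewrite card_nz_digit // card_ord cD -(ler_nat R) natrM !natrX natrD !natrM.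
set K := #|_|%:R => hK; have h4 : 0 < 4 ^+ M :> R by exact: exprn_gt0.
have e1 : 2 ^+ (4 * M) = 4 ^+ M * 4 ^+ M :> R.
  by rewrite exprM -exprMn; congr (_ ^+ M); ring.
have e2 : (q%:R * 2 + 2) ^+ N = (q%:R * 2) ^+ N * (1 + q%:R^-1) ^+ N :> R.
  by rewrite -exprMn; congr (_ ^+ N); field; rewrite gt_eqF.
have h2 : (q%:R * 2 + 2) ^+ N <= (q%:R * 2) ^+ N * 4 ^+ M :> R.
  rewrite e2 ler_wpM2l ?exprn_ge0 ?mulr_ge0 ?(ltW qR) // NE.
  exact: pow_succ_le.
have := le_trans hK h2; rewrite e1 mulrA ler_pM2r // => h3.
by rewrite mulrC ler_pdivlMr.
Qed.

(** * Choice of the parameters *)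

Theorem theorem2 (R : realType) (X : symmetric_space R)
    (X_neq_Linfty : ss_mem X <> @Linfty R)
    (limsup_phi :
      limf_esup (fun t : R => (fundamental_function X t * t `^ (- 2^-1))%:E) 0^'+ = +oo%E) :
  ~ property_IR X.
Proof.
move=> [gamma g0 IR].
have [p p0 [B1 _ hB]] := exists_approx_row_space g0.
have pR : 0 < p%:R :> R by rewrite ltr0n.
(* The threshold [48 p / gamma] is what [2 c / m <= gamma / 4] requires, given
   [sqrt (2 q) <= 6 p m]; asking for [q >= 4 p] makes [m] positive. *)
have T0 : 0 <= 48 * p%:R / gamma by rewrite divr_ge0 ?mulr_ge0 // ltW.
have [q [Qq q0 hT]] := exists_nat_fundamental_large limsup_phi (4 * p) T0.
have [|m /andP[hm1 hm2]] := @exists_nat_sqrt (4 * p) q; first by rewrite muln_gt0.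
have m0 : (0 < m)%N by case: m hm1 hm2 => // _; rewrite exp1n muln1 ltnNge Qq.
have mR : 0 < m%:R :> R by rewrite ltr0n.
pose c := (fundamental_function X q%:R^-1)^-1.
have phi0 : 0 < fundamental_function X q%:R^-1.
  by rewrite fundamental_function_gt0 // invr_gt0 ltr0n q0 invf_le1 ?ltr0n // ler1n.
have c0 : 0 < c by rewrite invr_gt0.
have hc : 2 * c / m%:R <= gamma / 4.
  (* As [m >= 1], [(m + 1)^2 <= 4 m^2], so [2 q < 32 p m^2 <= (6 p m)^2]. *)
  have hs : Num.sqrt (2 * q%:R) <= 6 * p%:R * m%:R :> R.
    have -> : 6 * p%:R * m%:R = Num.sqrt ((6 * p%:R * m%:R) ^+ 2) :> R.
      by rewrite sqrtr_sqr ger0_norm // !mulr_ge0.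
    rewrite ler_wsqrtr // -!natrM -natrX ler_nat.
    have h : (q < 4 * p * (4 * m ^ 2))%N.
      by apply: (leq_trans hm2); rewrite leq_mul2l; apply/orP; right; nia.
    have h2 : (p * m ^ 2 <= p * p * m ^ 2)%N by rewrite leq_mul2r leq_pmull ?orbT.
    rewrite !expnMn; nia.
  have := lt_le_trans hT (ler_wpM2l (ltW phi0) hs).
  rewrite -(ltr_pM2l c0) [_ * (_ * _)]mulrA /c mulVf ?gt_eqF // mul1r -/c.
  move=> h; rewrite ler_pdivrMr //.
  have : c * (48 * p%:R / gamma) * gamma < 6 * p%:R * m%:R * gamma by rewrite ltr_pM2r.
  have -> : c * (48 * p%:R / gamma) * gamma = p%:R * (48 * c).
    by field; rewrite gt_eqF.
  have -> : 6 * p%:R * m%:R * gamma = p%:R * (6 * m%:R * gamma) by ring.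
  by rewrite ltr_pM2l // => h'; lra.
have [|d /andP[d0 d1] hd] := fundamental_function_small X_neq_Linfty (e := gamma / (4 * c)).
  by rewrite divr_gt0 // mulr_gt0.
(* With [q], [m], [c] and [d] fixed, only [L] has to be large: [q * L >= B1] for the decoder and
   [4 ^- (p * L) <= d] for the exceptional set. *)
pose L := maxn B1 (Num.truncn d^-1).+1.
have [|G hG] := hB (q * L)%N.
  by rewrite /= (leq_trans (leq_maxl B1 (Num.truncn d^-1).+1)) // leq_pmull.
(* With [M = p * L] and [B = q * L] one has [N = q * M = p * B], and the requirement on [B] reduces
   to [4 p m^2 <= q]. *)
have [||f [fX find fint fnorm fwidth]] :=
    @exists_block_family R X q (p * L) (p * (q * L)) _ m (q * L) G q0 m0 _ _ hG.
- by rewrite mulnCA.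
- have -> : (m ^ 2 * (4 * (p * L)) = 4 * p * m ^ 2 * L)%N by ring.
  by rewrite leq_mul2r hm1 orbT.
have L0 : (0 < L)%N by rewrite leq_max orbT.
have := IR _ f _ fX find fint fnorm; rewrite !muln_gt0 p0 q0 L0 => /(_ isT) h.
have := le_trans h fwidth; rewrite lee_fin -/c => h'.
have hd' : c * fundamental_function X (4 ^- (p * L)) < gamma / 4.
  apply: (@le_lt_trans _ _ (c * fundamental_function X d)).
    rewrite ler_wpM2l ?(ltW c0) // fundamental_function_mono //.
    rewrite -[leRHS]invrK lef_pV2 ?posrE ?exprn_gt0 ?invr_gt0 //.
    apply: (@le_trans _ _ L%:R).
      apply: (le_trans (ltW (truncnS_gt _))); rewrite ler_nat; exact: leq_maxr.
    rewrite -natrX ler_nat; apply: (@leq_trans (p * L)); first exact: leq_pmull.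
    exact/ltnW/ltn_expl.
  have -> : gamma / 4 = c * (gamma / (4 * c)) by field; rewrite gt_eqF.
  by rewrite ltr_pM2l.
have := le_lt_trans h' (ler_ltD hc hd'); clear -g0; lra.
Qed.
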